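(* Let $n \geq 0$ be an integer such that $l = 2^{2^n} + 1$ is prime (a Fermat prime), and let $q = 2^{2^{n+1}}$. Then the Fermat curve $Y^l = X^l + Z^l$ over $\mathbf{F}_q$ is a Hermitian curve over $\mathbf{F}_q$ (that is, $l = q^{1/2}+1$) of genus $g = 2^{2^n - 1}(2^{2^n} - 1)$; moreover it is maximal over every finite extension of $\mathbf{F}_q$ of odd degree and minimal over every finite extension of $\mathbf{F}_q$ of even degree.
   Context: A non-singular projective curve $C$ of genus $g$ defined over a finite field $\mathbf{F}_Q$ is called maximal over $\mathbf{F}_Q$ if its number of $\mathbf{F}_Q$-rational points equals $Q + 1 + 2g\,Q^{1/2}$, and minimal over $\mathbf{F}_Q$ if this number equals $Q + 1 - 2g\,Q^{1/2}$. For $q$ a square, the Hermitian curve over $\mathbf{F}_q$ is the projective plane curve $Y^{q^{1/2}+1} = X^{q^{1/2}+1} + Z^{q^{1/2}+1}$. *)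

(* Defs.v *)
From HB Require Import structures.
From mathcomp Require Import all_boot all_order all_algebra all_field.
From mathcomp Require Import mpoly.

Set Implicit Arguments.
Unset Strict Implicit.
Unset Printing Implicit Defensive.

Import GRing.Theory Num.Theory.
Local Open Scope ring_scope.

(* A projective plane curve over k is given by a homogeneous polynomial in    *)
(* {mpoly k[3]}; the variables 0, 1, 2 are the coordinates X, Y, Z.           *)

Definition fermat (k : fieldType) (l : nat) : {mpoly k[3]} :=
  'X_1 ^+ l - ('X_0 ^+ l + 'X_2 ^+ l).

Definition hermitian_curve (k : finFieldType) (F : {mpoly k[3]}) : Prop :=
  exists2 s : nat, (s ^ 2)%N = #|k| & F = fermat k s.+1.

(* A point of P^2(k) is the set of its homogeneous coordinate vectors.        *)

Definition proj_point (k : finFieldType) (v : 'rV[k]_3) : {set 'rV[k]_3} :=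
  [set a *: v | a : k & a != 0].

Definition rational_points (k : finFieldType) (F : {mpoly k[3]}) :
    {set {set 'rV[k]_3}} :=
  [set proj_point v | v : 'rV[k]_3 & (v != 0) && (F.@[v 0] == 0)].

(* From here to regular_basis, k is meant to be algebraically closed, so that *)
(* the points with coordinates in k are all the closed points of the curve.   *)

Definition on_curve (k : fieldType) (F : {mpoly k[3]}) (p : 'rV[k]_3) : Prop :=
  p != 0 /\ F.@[p 0] = 0.

Definition smooth (k : fieldType) (F : {mpoly k[3]}) : Prop :=
  forall p : 'rV[k]_3, on_curve F p -> exists i : 'I_3, (F^`M(i)).@[p 0] != 0.

Section FunctionField.

Variables (k K : fieldType) (iota : {rmorphism k -> K}).
Implicit Types (F G H : {mpoly k[3]}) (xi : 'rV[K]_3) (p : 'rV[k]_3).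

Definition eval_at xi G : K := (map_mpoly iota G).@[xi 0].

(* K is the function field of F = 0 and xi its generic point: the homogeneous *)
(* forms vanishing at xi are the multiples of F (so F is irreducible), and K  *)
(* consists of the quotients of forms of the same degree.                     *)
Definition function_field F xi : Prop :=
  (forall (d : nat) G, G \is d.-homog ->
     (eval_at xi G = 0 <-> exists H, G = H * F)) /\
  (forall a : K, exists (d : nat) G H,
     [/\ G \is d.-homog, H \is d.-homog, eval_at xi H != 0
       & a = eval_at xi G / eval_at xi H]).

Definition local_ring xi p (a : K) : Prop :=
  exists (d : nat) G H,
    [/\ G \is d.-homog, H \is d.-homog, H.@[p 0] != 0
      & a = eval_at xi G / eval_at xi H].

Definition derivation (D : K -> K) : Prop :=
  [/\ forall a b, D (a + b) = D a + D b,
      forall a b, D (a * b) = a * D b + D a * b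
    & forall c : k, D (iota c) = 0].

(* The sequence of the pairs (f_i, g_i) stands for the Kaehler differential   *)
(* \sum_i f_i dg_i of K over k.  As Der_k(K, K) is the K-dual of the space of *)
(* Kaehler differentials, two of them are equal if and only if they have the  *)
(* same pairing with every derivation.                                        *)
Definition differential := seq (K * K).

Definition pairing (D : K -> K) (w : differential) : K :=
  \sum_(u <- w) u.1 * D u.2.

Definition eq_diff (w1 w2 : differential) : Prop :=
  forall D, derivation D -> pairing D w1 = pairing D w2.

Definition scale_diff (c : k) (w : differential) : differential :=
  [seq (iota c * u.1, u.2) | u <- w].

Definition lin_comb (n : nat) (c : 'I_n -> k) (w : 'I_n -> differential) :
    differential :=
  flatten [seq scale_diff (c i) (w i) | i <- enum 'I_n].

Definition regular_at xi p (w : differential) : Prop :=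
  exists2 w' : differential, eq_diff w w' &
    forall u, u \in w' -> local_ring xi p u.1 /\ local_ring xi p u.2.

Definition regular F xi (w : differential) : Prop :=
  forall p, on_curve F p -> regular_at xi p w.

(* w is a k-basis of the space of regular differentials.                      *)
Definition regular_basis F xi (n : nat) (w : 'I_n -> differential) : Prop :=
  [/\ forall i, regular F xi (w i),
      forall c, eq_diff (lin_comb c w) [::] -> forall i, c i = 0
    & forall v, regular F xi v -> exists c, eq_diff v (lin_comb c w)].

End FunctionField.

Definition algebraic_closure (k : fieldType) (kbar : closedFieldType)
    (iota : {rmorphism k -> kbar}) : Prop := integralRange iota.

Definition nonsingular_curve (k : fieldType) (F : {mpoly k[3]}) : Prop :=
  (exists2 d : nat, (0 < d)%N & F \is d.-homog) /\
  forall (kbar : closedFieldType) (iota : {rmorphism k -> kbar}),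
    algebraic_closure iota -> smooth (map_mpoly iota F).

(* The genus of a nonsingular curve is the dimension of its space of regular  *)
(* differentials, over an algebraic closure of the base field.                *)
Definition has_genus (k : fieldType) (F : {mpoly k[3]}) (g : nat) : Prop :=
  forall (kbar : closedFieldType) (iota : {rmorphism k -> kbar}),
    algebraic_closure iota ->
    exists (K : fieldType) (j : {rmorphism kbar -> K}) (xi : 'rV[K]_3),
      function_field j (map_mpoly iota F) xi /\
      exists w : 'I_g -> differential K,
        regular_basis j (map_mpoly iota F) xi w.

Definition maximal_curve (k : finFieldType) (F : {mpoly k[3]}) : Prop :=
  nonsingular_curve F /\
  exists2 g : nat, has_genus F g &
    #|rational_points F|%:R
      = #|k|%:R + 1 + 2 * g%:R * sqrtC #|k|%:R :> algC.

Definition minimal_curve (k : finFieldType) (F : {mpoly k[3]}) : Prop :=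
  nonsingular_curve F /\
  exists2 g : nat, has_genus F g &
    #|rational_points F|%:R
      = #|k|%:R + 1 - 2 * g%:R * sqrtC #|k|%:R :> algC.

(* finvect_type L is L itself, with the structure of a finite field.          *)
Definition base_change (k : finFieldType) (L : fieldExtType k)
    (F : {mpoly k[3]}) : {mpoly (finvect_type L)[3]} :=
  map_mpoly (in_alg (finvect_type L)) F.

(* Main.v *)
Require Import Defs.
From HB Require Import structures.
From mathcomp Require Import all_boot all_order all_algebra all_solvable all_field.
From mathcomp Require Import mpoly.
From mathcomp Require Import ring zify.

Set Implicit Arguments.
Unset Strict Implicit.
Unset Printing Implicit Defensive.

Import GRing.Theory Num.Theory.
Local Open Scope ring_scope.

(** Write s = 2^(2^n), so that l = s + 1 and q = s^2; the first claim is then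
    immediate, and smoothness follows from the partial derivatives
    l X^s, l Y^s, l Z^s, since l is odd and the characteristic is 2.

    Genus.  Let k be algebraically closed, l = e + 3 nonzero in k.  The function
    field is K = k(x)[y] / (y^l - x^l - 1): the polynomial is irreducible because
    x^l + 1 has a simple zero, by a norm argument
    ([irreducible_XnsubC], [exists_fermat_field]).  K has, up to a factor, one
    derivation D over k, with D x = y^(l-1) and D y = x^(l-1), so a differential
    is determined by its pairing phi with D; it is phi dx / y^(l-1).  As
    dx / y^(l-1) vanishes to order e along the line Z = 0 and nowhere else, the
    differential is regular if and only if phi is a global section of O(e)
    ([regular_pairing], [regular_monomial]).  Such sections are the forms of
    degree e ([global_section_form]): the automorphisms y -> z y with z^l = 1
    reduce the claim to phi = r(x) y^i, where evaluation of identities at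
    well-chosen points of the curve bounds the poles of r.  There are
    (e+2)(e+1)/2 = s(s-1)/2 monomials of degree e.

    Points.  Let k have Q = q^m elements and let Tr be the trace from k to the
    field of s elements.  Over the field of q elements the curve is isomorphic to
    u^s + u = x^l ([hermitian_polarization], [card_fermat_vectors]), and u exists,
    in s ways, exactly when Tr (x^l) = 0 ([card_artin_schreier]); so the number
    of points is 1 + s n_0, with n_c the number of x such that Tr (x^l) = c.
    The n_c with c <> 0 are equal.  Counting the pairs with
    Tr (x^l + y^l) = 0 in two ways gives (n_0 - n_1)^2 = q Q, hence
    n_0 - n_1 = + s^(m+1) or - s^(m+1).  The sign follows from the congruence
    n_0 = 1 modulo l, which holds because the l-th roots of unity act freely on
    the nonzero solutions ([dvdn_norm_fiber0], [sign_by_congruence]). *)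

(** * Irreducibility of Y^l - a and construction of the function field *)

Lemma mup_exp (k : fieldType) (z : k) (p : {poly k}) n :
  p != 0 -> mup z (p ^+ n) = (n * mup z p)%N.
Proof.
move=> p0; elim: n => [|n IHn].
  by rewrite expr0 mul0n mupNroot // root1.
by rewrite exprS mupM ?expf_neq0 // IHn mulSn.
Qed.

(** The determinant of the companion matrix of q is the norm of a root y of q.
    As y^l = a, its l-th power is the norm of a, that is a^d. *)
Lemma det_eq_norm (E : fieldType) (l : nat) (a : E) (q : {poly E}) :
  q \is monic -> q %| 'X^l - a%:P ->
  exists c : E, c ^+ l = a ^+ (size q).-1.
Proof.
move=> qmon qdvd; set d := (size q).-1.
suff normC n (C : 'M[E]_n) : char_poly C = q -> \det C ^+ l = a ^+ n.
  by exists (\det (companionmx q)); rewrite normC // companionmxK.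
case: n C => [|n] C charC; first by rewrite det_mx00 expr1n.
have Xl : C ^+ l = a%:M.
  have : horner_mx C ('X^l - a%:P) = 0.
    case/dvdpP: qdvd => r ->.
    by rewrite rmorphM /= -[X in _ * horner_mx C X]charC Cayley_Hamilton mulr0.
  by rewrite rmorphB /= rmorphXn /= horner_mx_X horner_mx_C => /subr0_eq.
have detX m : \det (C ^+ m) = \det C ^+ m.
  by elim: m => [|m IHm]; rewrite ?expr0 ?det1 // !exprS det_mulmx IHm.
by rewrite -detX Xl det_scalar.
Qed.

(** A monic factor of degree d yields through its norm an l-th root of a^d. *)
Lemma irreducible_XnsubC (E : fieldType) (l : nat) (a : E) :
  (0 < l)%N -> (forall (d : nat) (c : E), c ^+ l = a ^+ d -> (l %| d)%N) ->
  irreducible_poly ('X^l - a%:P).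
Proof.
move=> l0 ha; have szp : size ('X^l - a%:P) = l.+1 by rewrite size_XnsubC.
split=> [|q szq qdvd]; first by rewrite szp ltnS.
have p0 : 'X^l - a%:P != 0 by rewrite -size_poly_eq0 szp.
have q0 : q != 0 by apply: contraNneq p0 => q0; rewrite -dvd0p -q0.
pose q' := (lead_coef q)^-1 *: q.
have lq0 : (lead_coef q)^-1 != 0 by rewrite invr_eq0 lead_coef_eq0.
have szq' : size q' = size q by rewrite size_scale.
have qmon : q' \is monic by rewrite monicE lead_coefZ mulVf // lead_coef_eq0.
have q'dvd : q' %| 'X^l - a%:P by rewrite dvdpZl.
have [c /ha] := det_eq_norm qmon q'dvd.
rewrite -dvdp_size_eqp // szp szq' => /dvdn_leq; move: szq q0.
rewrite -size_poly_eq0; have := dvdp_leq p0 qdvd; rewrite szp.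
case: (size q) => [|[|d]] //= le_d _ _ /(_ isT) le_l.
by rewrite eqn_leq le_d.
Qed.

Lemma fractionP (R : idomainType) (c : {fraction R}) :
  exists u v : R, v != 0 /\ c = FracField.tofrac u / FracField.tofrac v.
Proof.
elim/quotW: c => c; exists (\n_c), (\d_c); have v0 := denom_ratioP c.
split=> //; apply: (canRL (mulfK _)); first by rewrite tofrac_eq0.
rewrite !piE; apply/eqmodP. rewrite /= FracField.equivfE.
by rewrite !numden_Ratio ?mulf_neq0 ?oner_eq0 // ?mulr1 mulrC.
Qed.

(** This is the hypothesis of [irreducible_XnsubC] over k(x): the multiplicity of
    z as a zero is a valuation, equal to 1 on a. *)
Lemma fraction_power (k : fieldType) (l : nat) (z : k) (a : {poly k}) d
    (c : {fraction {poly k}}) :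
  a != 0 -> mup z a = 1%N -> c ^+ l = FracField.tofrac a ^+ d -> (l %| d)%N.
Proof.
move=> a0 mua; have [u [v [v0 ->]]] := fractionP c.
rewrite expr_div_n -!tofracXn => /(canRL (divfK _)) eqF.
have /eqP : FracField.tofrac (u ^+ l) = FracField.tofrac (a ^+ d * v ^+ l).
  by rewrite tofracM eqF // tofrac_eq0 expf_neq0.
rewrite tofrac_eq => /eqP eq_uv.
have u0 : (0 < l)%N -> u != 0.
  move=> l0; have : u ^+ l != 0 by rewrite eq_uv mulf_neq0 ?expf_neq0.
  by rewrite expf_eq0 l0.
case: (posnP l) eq_uv u0 => [-> | l0 eq_uv /(_ isT) u0].
  rewrite !expr0 mulr1 => /(congr1 (mup z)).
  by rewrite mup_exp // mua muln1 mupNroot ?root1 // => <-.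
have /(congr1 (mup z)) := eq_uv; rewrite mupM ?expf_neq0 // !mup_exp // mua muln1.
by move=> e; rewrite -(dvdn_addl d (dvdn_mulr (mup z v) (dvdnn l))) -e dvdn_mulr.
Qed.

(** K = k(x, y) with y^l = x^l + 1, described by its basis 1, y, ..., y^(l-1) over
    k(x).  The independence clause also says that x is transcendental over k. *)
Definition fermat_field (k K : fieldType) (iota : {rmorphism k -> K})
    (l : nat) (x y : K) : Prop :=
  [/\ y ^+ l = x ^+ l + 1,
      forall c : 'I_l -> {poly k},
        \sum_i (map_poly iota (c i)).[x] * y ^+ i = 0 -> forall i, c i = 0
    & forall a : K, exists u v : 'I_l -> {poly k},
        (forall i, v i != 0) /\
        a = \sum_i (map_poly iota (u i)).[x] / (map_poly iota (v i)).[x]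
                   * y ^+ i].

Lemma horner_rmorphX (k : fieldType) (A : comNzRingType)
    (f : {rmorphism {poly k} -> A}) (u : {poly k}) :
  (map_poly (f \o polyC) u).[f 'X] = f u.
Proof.
by rewrite map_poly_comp horner_map -/(u \Po 'X) comp_polyXr.
Qed.

Lemma exists_root_field (E : fieldType) (P : {poly E}) :
  irreducible_poly P -> P \is monic ->
  exists (K : fieldType) (g : {rmorphism {poly E} -> K}),
    [/\ g P = 0, forall p : {poly E}, (size p < size P)%N -> g p = 0 -> p = 0
      & forall b, exists2 p : {poly E}, (size p < size P)%N & b = g p].
Proof.
move=> Pirr Pmon; pose mi : monic_irreducible_poly P := (Pirr, Pmon).
have mkP : mk_monic P = P by rewrite /mk_monic Pmon Pirr.1.
have gP : in_qpoly P P = 0.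
  by apply: val_inj; rewrite /= mkP Pdiv.RingMonic.rmodpp.
have g_inj (p : {poly E}) : (size p < size P)%N -> in_qpoly P p = 0 -> p = 0.
  by move=> szp /(congr1 val); rewrite /= Pdiv.Ring.rmodp_small // mkP.
have g_surj (b : {poly %/ P}) :
    exists2 p : {poly E}, (size p < size P)%N & b = in_qpoly P p.
  have szb := size_mk_monic b; exists (val b).
    by rewrite -[in X in (_ < X)%N]mkP.
  by apply: val_inj; rewrite /= Pdiv.Ring.rmodp_small.
by exists {poly %/ P with mi}, (in_qpoly P).
Qed.

Lemma exists_fermat_field (k : fieldType) (l : nat) (z : k) :
  (0 < l)%N -> mup z ('X^l + 1) = 1%N ->
  exists (K : fieldType) (iota : {rmorphism k -> K}) (x y : K),
    fermat_field iota l x y.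
Proof.
move=> l0 mua.
have a0 : 'X^l + 1 != 0 :> {poly k}.
  by rewrite -size_poly_eq0 -[1]opprK -polyC1 -polyCN size_XnsubC.
pose tf : {rmorphism {poly k} -> {fraction {poly k}}} := @FracField.tofrac {poly k}.
pose a := tf ('X^l + 1); pose P := 'X^l - a%:P.
have szP : size P = l.+1 by rewrite size_XnsubC.
have Pirr : irreducible_poly P.
  by apply: irreducible_XnsubC => // d c; apply: fraction_power mua.
have [K [g [gP g_inj g_surj]]] := exists_root_field Pirr (monicXnsubC a l0).
rewrite szP in g_inj g_surj.
pose f : {rmorphism {poly k} -> K} := g \o polyC \o tf.
exists K, (f \o polyC), (f 'X), (g 'X).
have g_sum (e : 'I_l -> {fraction {poly k}}) :
    \sum_i g (e i)%:P * g 'X ^+ i = g (\poly_(i < l) if insub i is Some j then e j else 0).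
  rewrite poly_def rmorph_sum; apply: eq_bigr => i _.
  by rewrite -rmorphXn -rmorphM mul_polyC valK.
split.
- have -> : f 'X ^+ l + 1 = g a%:P.
    by rewrite -rmorphXn -[1](rmorph1 f) -rmorphD.
  by apply/subr0_eq; rewrite -rmorphXn -rmorphB.
- move=> c; under eq_bigr do rewrite horner_rmorphX.
  rewrite (g_sum (fun i => tf (c i))) => /g_inj e0 i; apply/eqP.
  have /polyP/(_ i) := e0 (size_poly _ _).
  by rewrite coef_poly ltn_ord valK coef0 => /eqP; rewrite tofrac_eq0.
- move=> b; have [p szp ->] := g_surj b.
  have /fin_all_exists[uv uvP] : forall i : 'I_l, exists uv : {poly k} * {poly k},
      uv.2 != 0 /\ p`_i = tf uv.1 / tf uv.2.
    by move=> i; have [u [v]] := fractionP p`_i; exists (u, v).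
  exists (fun i => (uv i).1), (fun i => (uv i).2).
  split=> [i|]; first by case: (uvP i).
  have uvE (i : 'I_l) : p`_i = tf (uv i).1 / tf (uv i).2 by case: (uvP i).
  pose h : {rmorphism {fraction {poly k}} -> K} := g \o polyC.
  transitivity (\sum_(i < l) g (p`_i)%:P * g 'X ^+ i); last first.
    apply: eq_bigr => i _; 
    have hE : g (p`_i)%:P = h (tf (uv i).1) / h (tf (uv i).2).
      by rewrite -(fmorph_div h) -uvE.
    by rewrite hE; congr (_ / _ * _); apply: esym; apply: (horner_rmorphX f).
  rewrite (g_sum (fun i => p`_i)); congr (g _); apply/polyP => i.
  rewrite coef_poly; case: ltnP => [li|li]; last first.
    by rewrite nth_default // (leq_trans _ li).
  by rewrite insubT.
Qed.

(** * Derivations and automorphisms of the function field *)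

(** K is the field of fractions of the image of ev, but R itself may be a
    polynomial ring, on which maps are easily defined. *)
Section LiftToQuotients.

Variables (R : comNzRingType) (K : fieldType) (ev : {rmorphism R -> K}).
Hypothesis ev_frac : forall a : K, exists u v : R, ev v != 0 /\ a = ev u / ev v.

Fact ev_frac_sig (a : K) :
  exists uv : R * R, (ev uv.2 != 0) && (a == ev uv.1 / ev uv.2).
Proof.
by have [u [v [v0 ->]]] := ev_frac a; exists (u, v); rewrite v0 eqxx.
Qed.

(** Numerator and denominator of a chosen fraction with value a. *)
Let nd a := xchoose (ev_frac_sig a).

Fact nd_neq0 a : ev (nd a).2 != 0.
Proof. by have /andP[] := xchooseP (ev_frac_sig a). Qed.

Fact nd_numer a : ev (nd a).1 = a * ev (nd a).2.
Proof.
have /andP[v0 /eqP aE] := xchooseP (ev_frac_sig a).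
by rewrite [X in X * _]aE divfK.
Qed.

(** The quotient rule forces the value of D; that it does not depend on the chosen
    fraction is the stability of the kernel of ev under d. *)
Lemma lift_derivation (d : R -> R) :
  (forall u v, d (u + v) = d u + d v) ->
  (forall u v, d (u * v) = u * d v + d u * v) ->
  (forall u, ev u = 0 -> ev (d u) = 0) ->
  exists D : K -> K,
    [/\ forall a b, D (a + b) = D a + D b,
        forall a b, D (a * b) = a * D b + D a * b
      & forall u, D (ev u) = ev (d u)].
Proof.
move=> dD dM dker.
have d0 : d 0 = 0 by apply: (@addrI _ (d 0)); rewrite -dD !addr0.
have dN u : d (- u) = - d u by apply: (@addrI _ (d u)); rewrite -dD !subrr d0.
pose D a := (ev (d (nd a).1) - a * ev (d (nd a).2)) / ev (nd a).2.
have DE u v a : ev v != 0 -> ev u = a * ev v ->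
    D a = (ev (d u) - a * ev (d v)) / ev v.
  move=> v0 uE; apply/eqP; rewrite eqr_div ?nd_neq0 //; apply/eqP.
  have /dker : ev ((nd a).1 * v - u * (nd a).2) = 0.
    by rewrite rmorphB !rmorphM /= uE nd_numer; ring.
  rewrite dD dN !dM !(rmorphB, rmorphD, rmorphM) /= uE nd_numer => e.
  by apply/subr0_eq; rewrite -[RHS]e; ring.
exists D; split=> [a b|a b|u].
- have [va0 vb0] := (nd_neq0 a, nd_neq0 b).
  rewrite (@DE ((nd a).1 * (nd b).2 + (nd b).1 * (nd a).2) ((nd a).2 * (nd b).2)).
  + rewrite dD !dM !(rmorphD, rmorphM) /= !nd_numer /D.
    by field; rewrite va0 vb0.
  + by rewrite rmorphM mulf_neq0.
  + by rewrite !(rmorphD, rmorphM) /= !nd_numer; ring.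
- have [va0 vb0] := (nd_neq0 a, nd_neq0 b).
  rewrite (@DE ((nd a).1 * (nd b).1) ((nd a).2 * (nd b).2)).
  + rewrite !dM !(rmorphD, rmorphM) /= !nd_numer /D.
    by field; rewrite va0 vb0.
  + by rewrite rmorphM mulf_neq0.
  + by rewrite !(rmorphD, rmorphM) /= !nd_numer; ring.
- rewrite (@DE u 1); rewrite ?rmorph1 ?oner_eq0 ?mulr1 ?divr1 //.
  have d1 : d 1 = 0.
    by apply: (@addrI _ (d 1)); rewrite addr0 -[in RHS](mulr1 1) dM mulr1 mul1r.
  by rewrite d1 rmorph0 mulr0 subr0.
Qed.

Lemma lift_endomorphism (s : {rmorphism R -> R}) :
  (forall u, (ev (s u) == 0) = (ev u == 0)) ->
  exists sigma : {rmorphism K -> K}, forall u, sigma (ev u) = ev (s u).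
Proof.
move=> sker; pose sg a := ev (s (nd a).1) / ev (s (nd a).2).
have sgE u v a : ev v != 0 -> ev u = a * ev v -> sg a = ev (s u) / ev (s v).
  move=> v0 uE; apply/eqP; rewrite eqr_div ?sker ?nd_neq0 //; apply/eqP/subr0_eq.
  rewrite -!rmorphM -!rmorphB; apply/eqP; rewrite sker.
  by rewrite rmorphB !rmorphM /= uE nd_numer; apply/eqP; ring.
have sgev u : sg (ev u) = ev (s u).
  by rewrite (@sgE u 1); rewrite ?rmorph1 ?oner_eq0 ?mulr1 ?divr1.
have sg_add : zmod_morphism sg.
  move=> a b; have [va0 vb0] := (nd_neq0 a, nd_neq0 b).
  rewrite (@sgE ((nd a).1 * (nd b).2 - (nd b).1 * (nd a).2) ((nd a).2 * (nd b).2)).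
  + rewrite !(rmorphB, rmorphM) /= /sg.
    by field; rewrite !sker va0 vb0.
  + by rewrite rmorphM mulf_neq0.
  + by rewrite !(rmorphB, rmorphM) /= !nd_numer; ring.
have sg_mul : monoid_morphism sg.
  split=> [|a b]; first by rewrite -(rmorph1 ev) sgev rmorph1.
  have [va0 vb0] := (nd_neq0 a, nd_neq0 b).
  rewrite (@sgE ((nd a).1 * (nd b).1) ((nd a).2 * (nd b).2)).
  + rewrite !(rmorphB, rmorphM) /= /sg.
    by field; rewrite !sker va0 vb0.
  + by rewrite rmorphM mulf_neq0.
  + by rewrite !(rmorphB, rmorphM) /= !nd_numer; ring.
pose A := GRing.isZmodMorphism.Build K K sg sg_add.
pose M := GRing.isMonoidMorphism.Build K K sg sg_mul.
pose sigma : {rmorphism K -> K} := HB.pack sg A M.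
by exists sigma.
Qed.

End LiftToQuotients.

Section Derivations.

Variables (k K : fieldType) (iota : {rmorphism k -> K}) (D : K -> K).
Hypothesis hD : derivation iota D.

Lemma derivation1 : D 1 = 0.
Proof. by have [_ _ Dc] := hD; rewrite -(rmorph1 iota) Dc. Qed.

Lemma derivation0 : D 0 = 0.
Proof. by have [_ _ Dc] := hD; rewrite -{1}(rmorph0 iota) Dc. Qed.

Lemma derivationX a n : D (a ^+ n) = a ^+ n.-1 * D a *+ n.
Proof.
have [_ DM _] := hD; elim: n => [|n IHn]; first by rewrite expr0 derivation1.
case: n IHn => [|n] IHn; first by rewrite expr1 expr0 mul1r.
by rewrite exprS DM IHn /= mulrnAr mulrA -exprS [D a * _]mulrC -mulrSr.
Qed.

Lemma derivationV a : D a^-1 = - D a / a ^+ 2.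
Proof.
have [_ DM _] := hD; have [->|a0] := eqVneq a 0.
  by rewrite invr0 derivation0 oppr0 mul0r.
have := derivation1; rewrite -(mulfV a0) DM => /eqP.
by rewrite addr_eq0 => /eqP e; apply: (mulfI a0); rewrite e; field.
Qed.

End Derivations.

Section FermatField.

Variables (k K : fieldType) (iota : {rmorphism k -> K}) (l : nat) (x y : K).
Hypotheses (l_gt0 : (0 < l)%N) (hK : fermat_field iota l x y).

Let curve_eq : y ^+ l = x ^+ l + 1. Proof. by case: hK. Qed.

Local Notation evx := (fun u : {poly k} => (map_poly iota u).[x]).

Let ex : {rmorphism {poly k} -> K} := horner_eval x \o map_poly iota.
Let ev : {rmorphism {poly {poly k}} -> K} := horner_eval y \o map_poly ex.
Let f : {poly {poly k}} := 'X^l - ('X^l + 1)%:P.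

Lemma evx_eq0 (u : {poly k}) : (map_poly iota u).[x] = 0 -> u = 0.
Proof.
case: hK => _ indep _ ux0; pose i0 := Ordinal l_gt0.
pose c i := if i == i0 then u else 0.
suff c0 : \sum_i evx (c i) * y ^+ i = 0.
  by have := indep c c0 i0; rewrite /c eqxx.
rewrite (bigD1 i0) //= /c eqxx ux0 mul0r add0r big1 // => i /negPf i0F.
by rewrite /c i0F map_poly0 horner0 mul0r.
Qed.

Lemma fermat_field_ind (P : K -> Prop) :
  (forall c, P (iota c)) -> P x -> P y ->
  (forall a b, P a -> P b -> P (a + b)) ->
  (forall a b, P a -> P b -> P (a * b)) ->
  (forall a, P a -> P a^-1) -> forall a, P a.
Proof.
move=> Pc Px Py PD PM PV a; have [_ _ /(_ a)[u [v [_ ->]]]] := hK.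
have P0 : P 0 by rewrite -(rmorph0 iota).
have PX b n : P b -> P (b ^+ n).
  by move=> Pb; elim: n => [|n Pbn]; rewrite ?exprS ?expr0 -?(rmorph1 iota); auto.
have Pu (w : {poly k}) : P (map_poly iota w).[x].
  rewrite horner_coef; apply: big_ind => // i _.
  by rewrite coef_map; apply: PM; [apply: Pc | apply: PX].
by apply: big_ind => // i _; apply: (PM _ _ (PM _ _ (Pu _) (PV _ (Pu _))) (PX _ _ Py)).
Qed.

Let ev_X : ev 'X = y.
Proof. by rewrite /= map_polyX /horner_eval hornerX. Qed.

Let ev_C u : ev u%:P = ex u.
Proof. by rewrite /= map_polyC /horner_eval hornerC. Qed.

Let ex_X : ex 'X = x.
Proof. by rewrite /= map_polyX /horner_eval hornerX. Qed.

Let ex_C c : ex c%:P = iota c.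
Proof. by rewrite /= map_polyC /horner_eval hornerC. Qed.

Let ev_f : ev f = 0.
Proof.
by rewrite rmorphB rmorphXn ev_X ev_C rmorphD rmorphXn ex_X rmorph1 curve_eq subrr.
Qed.

(** f is monic of degree l in y, so the remainder of the division by f is a
    combination of 1, y, ..., y^(l-1). *)
Lemma bivariate_kernel P : ev P = 0 -> exists Q, P = Q * f.
Proof.
have fmon : f \is monic by rewrite monicXnsubC.
rewrite (Pdiv.RingMonic.rdivp_eq fmon P) rmorphD rmorphM ev_f mulr0 add0r => r0.
set Q := Pdiv.Ring.rdivp P f; exists Q.
suff -> : Pdiv.Ring.rmodp P f = 0 by rewrite addr0.
have := Pdiv.Ring.ltn_rmodp P f; rewrite monic_neq0 //.
set r := Pdiv.Ring.rmodp P f in r0 *; rewrite size_XnsubC // ltnS => szr.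
have [_ indep _] := hK.
have r_i := indep (fun i => r`_i).
apply/polyP => i; rewrite coef0; case: (ltnP i l) => [li|li].
  apply: (r_i _ (Ordinal li)); rewrite -[RHS]r0 -[ev r]/((map_poly ex r).[y]).
  rewrite (horner_coef_wide y (leq_trans (size_poly _ _) szr)).
  by apply: eq_bigr => j _; rewrite coef_map.
by rewrite nth_default // (leq_trans szr).
Qed.

Lemma bivariate_fractions (a : K) : exists u v, ev v != 0 /\ a = ev u / ev v.
Proof.
move: a; apply: fermat_field_ind => [c|||a b|a b|a].
- by exists c%:P%:P, 1; rewrite rmorph1 oner_eq0 divr1 ev_C ex_C.
- by exists 'X%:P, 1; rewrite rmorph1 oner_eq0 divr1 ev_C ex_X.
- by exists 'X, 1; rewrite rmorph1 oner_eq0 divr1 ev_X.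
- move=> [u [v [v0 ->]]] [u' [v' [v0' ->]]]; exists (u * v' + u' * v), (v * v').
  by rewrite rmorphM mulf_neq0 // addf_div // rmorphD !rmorphM.
- move=> [u [v [v0 ->]]] [u' [v' [v0' ->]]]; exists (u * u'), (v * v').
  by rewrite !rmorphM mulf_neq0 // mulf_div.
- move=> [u [v [v0 ->]]]; rewrite invf_div.
  have [->|u0] := eqVneq (ev u) 0; last by exists v, u.
  by exists 0, 1; rewrite rmorph0 rmorph1 invr0 mulr0 oner_eq0 mul0r.
Qed.

(** The derivation of k[x, y] with dx = y^(l-1) and dy = x^(l-1) kills
    y^l - x^l - 1, hence preserves the ideal that it generates. *)
Lemma fermat_derivation :
  exists D : K -> K,
    [/\ derivation iota D, D x = y ^+ l.-1 & D y = x ^+ l.-1].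
Proof.
pose d (P : {poly {poly k}}) :=
  'X^(l.-1) * map_poly (@deriv k) P + ('X^(l.-1))%:P * P^`().
have mdM (P Q : {poly {poly k}}) :
    map_poly (@deriv k) (P * Q)
      = P * map_poly (@deriv k) Q + map_poly (@deriv k) P * Q.
  apply/polyP => n; rewrite coefD coef_map !coefM /= raddf_sum -big_split.
  by apply: eq_bigr => i _; rewrite !coef_map /= derivM addrC.
have dD P Q : d (P + Q) = d P + d Q.
  by rewrite /d raddfD derivD; ring.
have dM P Q : d (P * Q) = P * d Q + d P * Q.
  by rewrite /d mdM derivM; ring.
have mC (u : {poly k}) : map_poly (@deriv k) u%:P = u^`()%:P by rewrite map_polyC.
have dC u : d u%:P = 'X^(l.-1) * u^`()%:P by rewrite /d mC derivC mulr0 addr0.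
have mXn n : map_poly (@deriv k) 'X^n = 0.
  apply/polyP => i; rewrite coef_map coefXn coef0 /=.
  by case: (i == n); rewrite ?derivC ?deriv0 // -polyC1 derivC.
have df : d f = 0.
  rewrite {1}/d /f raddfB /= mXn mC !derivE; ring.
have dker P : ev P = 0 -> ev (d P) = 0.
  by case/bivariate_kernel => Q ->; rewrite dM df mulr0 add0r rmorphM ev_f mulr0.
have [D [DD DM Dev]] := lift_derivation bivariate_fractions dD dM dker.
exists D; split.
- split=> // c; rewrite -ex_C -ev_C Dev dC derivC mulr0.
  exact: rmorph0.
- by rewrite -ex_X -ev_C Dev dC derivX mulr1 rmorphXn ev_X.
- by rewrite -ev_X Dev /d -['X]expr1 mXn mulr0 add0r !derivE mulr1 ev_C rmorphXn ex_X.
Qed.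

Lemma fermat_x_neq0 : x != 0.
Proof.
apply/eqP => x0; have := @evx_eq0 'X; rewrite map_polyX hornerX => /(_ x0)/eqP.
by rewrite polyX_eq0.
Qed.

Lemma fermat_y_neq0 : y != 0.
Proof.
apply/eqP => y0; have := curve_eq; rewrite y0 expr0n gtn_eqF //= => /esym e.
have /eqP : ('X^l + 1 : {poly k}) = 0.
  by apply: evx_eq0; rewrite rmorphD rmorph1 /= map_polyXn !hornerE.
by rewrite -[1]opprK -polyC1 -polyCN -size_poly_eq0 size_XnsubC.
Qed.

(** Differentiating y^l = x^l + 1 determines D' y from D' x, and K is generated by
    x and y. *)
Lemma derivation_unique (D D' : K -> K) :
  (l%:R : K) != 0 -> derivation iota D -> derivation iota D' ->
  D x = y ^+ l.-1 -> D y = x ^+ l.-1 ->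
  exists t, forall a, D' a = t * D a.
Proof.
move=> lK hD hD' Dx Dy; have y0 := fermat_y_neq0.
have yl0 : y ^+ l.-1 != 0 by rewrite expf_neq0.
pose t := D' x / y ^+ l.-1; exists t.
have D'x : D' x = t * y ^+ l.-1 by rewrite divfK.
have [DD DM Dc] := hD; have [DD' DM' Dc'] := hD'.
apply: fermat_field_ind => [c|||a b Ha Hb|a b Ha Hb|a Ha].
- by rewrite Dc Dc' mulr0.
- by rewrite Dx D'x.
- rewrite Dy; apply: (mulfI lK); apply: (mulfI yl0).
  have := congr1 D' curve_eq; rewrite DD' -[1](rmorph1 iota) Dc' addr0.
  rewrite !(derivationX hD') D'x => e.
  transitivity (y ^+ l.-1 * D' y *+ l); first by rewrite -mulr_natl; ring.
  by rewrite e -mulr_natl; ring.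
- by rewrite DD DD' Ha Hb mulrDr.
- by rewrite DM DM' Ha Hb; ring.
- by rewrite (derivationV hD) (derivationV hD') Ha; ring.
Qed.

(** The substitution of z y for y preserves y^l - x^l - 1. *)
Lemma fermat_automorphism (z : k) : z ^+ l = 1 ->
  exists sigma : {rmorphism K -> K},
    [/\ forall c, sigma (iota c) = iota c, sigma x = x
      & sigma y = iota z * y].
Proof.
move=> zl; have z0 : z != 0.
  by apply: contraTneq (oner_neq0 k) => z0; rewrite -zl z0 expr0n gtn_eqF ?eqxx.
pose s c : {rmorphism {poly {poly k}} -> {poly {poly k}}} :=
  comp_poly (c%:P *: 'X).
have sX c : s c 'X = c%:P *: 'X by rewrite /= comp_polyX.
have sC c u : s c u%:P = u%:P by rewrite /= comp_polyC.
have sZ c u P : s c (u *: P) = u *: s c P by rewrite -!mul_polyC rmorphM sC.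
have sf c : c ^+ l = 1 -> s c f = f.
  move=> cl; rewrite rmorphB rmorphXn sX sC exprZn -polyC_exp cl scale1r.
  by [].
have sker c P : c ^+ l = 1 -> ev P = 0 -> ev (s c P) = 0.
  by move=> cl /bivariate_kernel[Q ->]; rewrite rmorphM sf // rmorphM ev_f mulr0.
have sK P : s z^-1 (s z P) = P.
  have -> : s z^-1 (s z P) = P \Po s z^-1 (z%:P *: 'X) by rewrite /= comp_polyA.
  by rewrite sZ sX scalerA -polyCM mulfV // scale1r comp_polyXr.
have skerE P : (ev (s z P) == 0) = (ev P == 0).
  apply/eqP/eqP => [eP|]; last exact: sker.
  by rewrite -[P]sK; apply: sker; rewrite // exprVn zl invr1.
have [sigma sigmaE] := lift_endomorphism bivariate_fractions skerE.
exists sigma; split=> [c||].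
- by rewrite -ex_C -ev_C sigmaE sC.
- by rewrite -ex_X -ev_C sigmaE sC.
- by rewrite -ev_X sigmaE sX -mul_polyC rmorphM ev_C ex_C.
Qed.

End FermatField.

(** * Forms modulo the Fermat form *)
Section Forms.

Variables (k : fieldType) (l : nat).
Hypothesis l_gt0 : (0 < l)%N.

Local Notation F := (fermat k l).

Lemma mpolyX3 (m : 'X_{1..3}) :
  'X_[m] = 'X_0 ^+ m 0 * 'X_1 ^+ m 1 * 'X_2 ^+ m 2 :> {mpoly k[3]}.
Proof.
rewrite mpolyXE_id 3!big_ord_recl big_ord0 mulr1 mulrA.
by congr ('X_ _ ^+ m _ * 'X_ _ ^+ m _ * 'X_ _ ^+ m _); apply: val_inj.
Qed.

Lemma mdeg3 (m : 'X_{1..3}) : mdeg m = (m 0%R + m 1%R + m 2%R)%N.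
Proof.
rewrite mdegE 3!big_ord_recl big_ord0 addn0 addnA.
by congr (m _ + m _ + m _)%N; apply: val_inj.
Qed.

Lemma homog_ind (P : {mpoly k[3]} -> Prop) d :
  P 0 -> (forall G H, P G -> P H -> P (G + H)) ->
  (forall c a b e, (a + b + e)%N = d ->
     P (c *: ('X_0 ^+ a * 'X_1 ^+ b * 'X_2 ^+ e))) ->
  forall G, G \is d.-homog -> P G.
Proof.
move=> P0 PD PX G /dhomogP hG; rewrite [G]mpolyE big_seq.
by apply: big_ind => // m /hG dm; rewrite mpolyX3; apply: PX; rewrite -mdeg3.
Qed.

Lemma homogX (i : 'I_3) n : 'X_i ^+ n \is [in k[3], n.-homog].
Proof.
have X1 : 'X_i \is [in k[3], 1.-homog] by rewrite dhomogX; apply/eqP/mdeg1.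
by have := dhomogMn n X1; rewrite mul1n.
Qed.

Lemma fermat_homog : F \is l.-homog.
Proof. by rewrite rpredB ?rpredD ?homogX. Qed.

Definition homogenize m (u : {poly k}) : {mpoly k[3]} :=
  \sum_(j < m.+1) u`_j *: ('X_0 ^+ j * 'X_2 ^+ (m - j)).

Lemma homogenizeD m u v :
  homogenize m (u + v) = homogenize m u + homogenize m v.
Proof.
by rewrite -big_split; apply: eq_bigr => j _; rewrite coefD scalerDl.
Qed.

Lemma homogenizeZ m c u : homogenize m (c *: u) = c *: homogenize m u.
Proof.
by rewrite scaler_sumr; apply: eq_bigr => j _; rewrite coefZ scalerA.
Qed.

Lemma homogenizeX m a : (a <= m)%N ->
  homogenize m 'X^a = 'X_0 ^+ a * 'X_2 ^+ (m - a).
Proof.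
rewrite -ltnS => am; rewrite /homogenize (bigD1 (Ordinal am)) //= coefXn eqxx.
rewrite scale1r big1 ?addr0 // => j; rewrite -val_eqE /= => /negPf ja.
by rewrite coefXn ja scale0r.
Qed.

Definition normal_form d (c : 'I_l -> {poly k}) : {mpoly k[3]} :=
  \sum_(i < l) homogenize (d - i) (c i) * 'X_1 ^+ i.

Lemma normal_formD d c c' :
  normal_form d (fun i => c i + c' i) = normal_form d c + normal_form d c'.
Proof.
by rewrite -big_split; apply: eq_bigr => i _; rewrite homogenizeD mulrDl.
Qed.

Lemma normal_formZ d a c :
  normal_form d (fun i => a *: c i) = a *: normal_form d c.
Proof.
by rewrite scaler_sumr; apply: eq_bigr => i _; rewrite homogenizeZ scalerAl.
Qed.

(** Division of a form of degree d by F, which is monic in Y: the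
    remainder is a sum of terms c_i(X, Z) Y^i with i < l. *)
Definition has_normal_form d G : Prop :=
  exists (H : {mpoly k[3]}) (c : 'I_l -> {poly k}),
    (forall i : 'I_l, (size (c i) <= d.+1 - i)%N) /\ G = H * F + normal_form d c.

Lemma has_normal_formD d G G' :
  has_normal_form d G -> has_normal_form d G' -> has_normal_form d (G + G').
Proof.
move=> [H [c [szc ->]]] [H' [c' [szc' ->]]].
exists (H + H'), (fun i => c i + c' i); split=> [i|].
  by rewrite (leq_trans (size_polyD _ _)) // geq_max szc szc'.
by rewrite normal_formD mulrDl addrACA.
Qed.

Lemma has_normal_formZ d a G : has_normal_form d G -> has_normal_form d (a *: G).
Proof.
move=> [H [c [szc ->]]]; exists (a *: H), (fun i => a *: c i); split=> [i|].
  by rewrite (leq_trans (size_scale_leq _ _)).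
by rewrite normal_formZ scalerDr scalerAl.
Qed.

Lemma has_normal_form_mult d G H :
  has_normal_form d G -> has_normal_form d (H * F + G).
Proof.
move=> [H' [c [szc ->]]]; exists (H + H'), c; split=> //.
by rewrite mulrDl addrA.
Qed.

(** Y^b with b >= l is rewritten by means of Y^l = F + X^l + Z^l, which preserves
    the degree. *)
Lemma fermat_division d G : G \is d.-homog -> has_normal_form d G.
Proof.
apply: homog_ind => {G} [|G G'|c a b e dE].
- exists 0, (fun i => 0 *: 0); split=> [i|]; first by rewrite scale0r size_poly0.
  by rewrite normal_formZ scale0r mul0r addr0.
- exact: has_normal_formD.
apply: has_normal_formZ; elim/ltn_ind: b a e dE => b IHb a e dE.
have [lb|bl] := ltnP b l; last first.
  have -> : 'X_0 ^+ a * 'X_1 ^+ b * 'X_2 ^+ e =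
      ('X_0 ^+ a * 'X_1 ^+ (b - l) * 'X_2 ^+ e) * F
      + ('X_0 ^+ (a + l) * 'X_1 ^+ (b - l) * 'X_2 ^+ e
         + 'X_0 ^+ a * 'X_1 ^+ (b - l) * 'X_2 ^+ (e + l)) :> {mpoly k[3]}.
    by rewrite /fermat -[in LHS](subnK bl) !exprD; ring.
  apply: has_normal_form_mult; apply: has_normal_formD; apply: IHb; lia.
exists 0, (fun i => ((i == Ordinal lb)%:R : k) *: 'X^a); split=> [i|].
  case: eqP => [->|_]; last by rewrite scale0r size_poly0.
  by rewrite scale1r size_polyXn /=; lia.
rewrite mul0r add0r /normal_form (bigD1 (Ordinal lb)) //= eqxx scale1r.
rewrite homogenizeX; last lia.
rewrite big1 ?addr0 => [|i /negPf->]; last by rewrite homogenizeZ scale0r mul0r.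
have -> : (d - b - a = e)%N by lia.
by ring.
Qed.

End Forms.

(** * The generic point and the local rings *)
Section FermatFunctionField.

Variables (k K : fieldType) (iota : {rmorphism k -> K}) (l : nat) (x y : K).
Hypotheses (l_gt0 : (0 < l)%N) (hK : fermat_field iota l x y).

Local Notation F := (fermat k l).

Definition generic_point : 'rV[K]_3 :=
  \row_(i < 3) (if i == 0 then x else if i == 1 then y else 1).
Local Notation xi := generic_point.

Definition form_eval : {rmorphism {mpoly k[3]} -> K} := meval (xi 0) \o map_mpoly iota.

Lemma form_evalE G : eval_at iota xi G = form_eval G. Proof. by []. Qed.

Lemma form_eval_X0 : form_eval 'X_0 = x.
Proof. by rewrite /= map_mpolyX mevalXU mxE. Qed.
Lemma form_eval_X1 : form_eval 'X_1 = y.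
Proof. by rewrite /= map_mpolyX mevalXU mxE. Qed.
Lemma form_eval_X2 : form_eval 'X_2 = 1.
Proof. by rewrite /= map_mpolyX mevalXU mxE. Qed.

Lemma form_eval_C c : form_eval c%:MP = iota c.
Proof. by rewrite /= map_mpolyC mevalC. Qed.

Lemma form_eval_Z c G : form_eval (c *: G) = iota c * form_eval G.
Proof. by rewrite -mul_mpolyC rmorphM form_eval_C. Qed.

Lemma form_eval_fermat : form_eval F = 0.
Proof.
rewrite rmorphB rmorphD !rmorphXn form_eval_X0 form_eval_X1 form_eval_X2 expr1n.
by have [-> _ _] := hK; rewrite subrr.
Qed.

Lemma form_eval_homogenize m (u : {poly k}) :
  (size u <= m.+1)%N -> form_eval (homogenize m u) = (map_poly iota u).[x].
Proof.
move=> szu; rewrite (horner_coef_wide x (leq_trans (size_poly _ _) szu)).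
rewrite rmorph_sum; apply: eq_bigr => j _.
by rewrite form_eval_Z rmorphM !rmorphXn form_eval_X0 form_eval_X2 expr1n mulr1 coef_map.
Qed.

Lemma form_eval_normal_form d (c : 'I_l -> {poly k}) :
  (forall i : 'I_l, (size (c i) <= d.+1 - i)%N) ->
  form_eval (normal_form d c) = \sum_i (map_poly iota (c i)).[x] * y ^+ i.
Proof.
move=> szc; rewrite rmorph_sum; apply: eq_bigr => i _.
rewrite rmorphM rmorphXn form_eval_X1 form_eval_homogenize //.
by have := szc i; lia.
Qed.

Lemma form_eval_eq0 d G : G \is d.-homog -> form_eval G = 0 <-> exists H, G = H * F.
Proof.
move=> /(fermat_division l_gt0)[H [c [szc ->]]].
split=> [|[H' ->]]; last by rewrite rmorphM form_eval_fermat mulr0.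
rewrite rmorphD rmorphM form_eval_fermat mulr0 add0r form_eval_normal_form //.
have [_ indep _] := hK => /indep c0; exists H.
rewrite /normal_form big1 ?addr0 // => i _.
by rewrite c0 /homogenize big1 ?mul0r // => j _; rewrite coef0 scale0r.
Qed.

Lemma fermat_function_field : function_field iota F xi.
Proof.
split=> [d G hG|a]; first exact: form_eval_eq0 hG.
have X1 i : 'X_i \is [in k[3], 1.-homog] by exact: (homogX k i 1).
have one0 : (1 : {mpoly k[3]}) \is 0.-homog by exact: dhomog1.
move: a; apply: (fermat_field_ind hK) => [c|||a b|a b|a].
- exists 0%N, c%:MP, 1; rewrite !form_evalE rmorph1 form_eval_C divr1 oner_eq0; split=> //.
  by rewrite -[c]mulr1 mpolyCM mul_mpolyC rpredZ.
- by exists 1%N, 'X_0, 'X_2; rewrite !form_evalE form_eval_X0 form_eval_X2 divr1 oner_eq0.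
- by exists 1%N, 'X_1, 'X_2; rewrite !form_evalE form_eval_X1 form_eval_X2 divr1 oner_eq0.
- move=> [d [G [H [hG hH H0 ->]]]] [d' [G' [H' [hG' hH' H0' ->]]]].
  rewrite !form_evalE in H0 H0' *; exists (d + d')%N, (G * H' + H * G'), (H * H').
  rewrite !form_evalE rmorphD !rmorphM addf_div // [form_eval G' * form_eval H]mulrC; split=> //.
  + by apply: rpredD; apply: dhomogM.
  + exact: dhomogM.
  + exact: mulf_neq0.
- move=> [d [G [H [hG hH H0 ->]]]] [d' [G' [H' [hG' hH' H0' ->]]]].
  rewrite !form_evalE in H0 H0' *; exists (d + d')%N, (G * G'), (H * H').
  rewrite !form_evalE !rmorphM mulf_div; split=> //; try exact: dhomogM.
  exact: mulf_neq0.
- move=> [d [G [H [hG hH H0 ->]]]]; rewrite !form_evalE in H0 *; rewrite invf_div.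
  have [->|G0] := eqVneq (form_eval G) 0; last by exists d, H, G; rewrite !form_evalE.
  exists 0%N, 0, 1; rewrite !form_evalE rmorph1 rmorph0 invr0 mulr0 mul0r oner_eq0.
  by split=> //; apply: rpred0.
Qed.

Section Residues.

Variable p : 'rV[k]_3.
Hypothesis Cp : on_curve F p.

(** The function a is defined at p and takes there the value c.  Carrying the value
    along turns an identity in K into an identity in k, by [residue_uniq]. *)
Definition residue (a : K) (c : k) : Prop :=
  exists (d : nat) G H,
    [/\ G \is d.-homog, H \is d.-homog, H.@[p 0] != 0
      & a * form_eval H = form_eval G /\ c = G.@[p 0] / H.@[p 0]].

Lemma vanish_on_curve d G : G \is d.-homog -> form_eval G = 0 -> G.@[p 0] = 0.
Proof.
by move=> hG /(form_eval_eq0 hG)[H ->]; rewrite mevalM Cp.2 mulr0.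
Qed.

Lemma form_eval_neq0 d G : G \is d.-homog -> G.@[p 0] != 0 -> form_eval G != 0.
Proof. by move=> hG; apply: contra_neq; apply: vanish_on_curve hG. Qed.

Lemma residue_local a c : residue a c -> local_ring iota xi p a.
Proof.
move=> [d [G [H [hG hH Hp [e _]]]]]; exists d, G, H; split=> //.
by rewrite !form_evalE -e mulfK // (form_eval_neq0 hH).
Qed.

Lemma local_residue a : local_ring iota xi p a -> exists c, residue a c.
Proof.
move=> [d [G [H [hG hH Hp ->]]]]; exists (G.@[p 0] / H.@[p 0]), d, G, H.
by split=> //; rewrite !form_evalE divfK // (form_eval_neq0 hH).
Qed.

Lemma residueD a b c e : residue a c -> residue b e -> residue (a + b) (c + e).
Proof.
move=> [d [G [H [hG hH Hp [aE ->]]]]] [d' [G' [H' [hG' hH' Hp' [bE ->]]]]].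
exists (d + d')%N, (G * H' + H * G'), (H * H'); split.
- by apply: rpredD; apply: dhomogM.
- exact: dhomogM.
- by rewrite mevalM mulf_neq0.
split; first by rewrite rmorphD !rmorphM -aE -bE; ring.
by rewrite mevalD !mevalM addf_div // [G'.@[p 0] * _]mulrC.
Qed.

Lemma residueM a b c e : residue a c -> residue b e -> residue (a * b) (c * e).
Proof.
move=> [d [G [H [hG hH Hp [aE ->]]]]] [d' [G' [H' [hG' hH' Hp' [bE ->]]]]].
exists (d + d')%N, (G * G'), (H * H'); split.
- exact: dhomogM.
- exact: dhomogM.
- by rewrite mevalM mulf_neq0.
split; first by rewrite !rmorphM -aE -bE; ring.
by rewrite !mevalM mulf_div.
Qed.

Lemma residueC c : residue (iota c) c.
Proof.
exists 0%N, c%:MP, 1; rewrite (rmorph1 form_eval) form_eval_C meval1 mevalC divr1 mulr1 oner_eq0.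
split=> //; last exact: dhomog1.
by rewrite -[c]mulr1 mpolyCM mul_mpolyC rpredZ // dhomog1.
Qed.

Lemma residueX a c n : residue a c -> residue (a ^+ n) (c ^+ n).
Proof.
move=> rac; elim: n => [|n IHn]; last by rewrite !exprS; apply: residueM.
by rewrite !expr0 -(rmorph1 iota); apply: residueC.
Qed.

Lemma residueV a c : residue a c -> c != 0 -> residue a^-1 c^-1.
Proof.
move=> [d [G [H [hG hH Hp [aE ->]]]]] c0.
have Gp : G.@[p 0] != 0 by move: c0; rewrite mulf_eq0 negb_or => /andP[].
exists d, H, G; split=> //; rewrite invf_div; split=> //.
have a0 : a != 0.
  by apply: contraNneq (form_eval_neq0 hG Gp) => a0; rewrite -aE a0 mul0r.
by rewrite -aE mulKf.
Qed.

Lemma residue0 c : residue 0 c -> c = 0.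
Proof.
move=> [d [G [H [hG hH Hp [aE ->]]]]].
by rewrite (vanish_on_curve hG) ?mul0r // -aE mul0r.
Qed.

Lemma residue_uniq a c e : residue a c -> residue a e -> c = e.
Proof.
move=> rc /(residueM (residueC (-1))) /(residueD rc).
rewrite rmorphN rmorph1 !mulN1r subrr => /residue0 e0.
by apply/subr0_eq.
Qed.

Lemma residue_ratio (i j : 'I_3) :
  p 0 j != 0 -> residue (xi 0 i / xi 0 j) (p 0 i / p 0 j).
Proof.
have X1 n : 'X_n \is [in k[3], 1.-homog] by exact: (homogX k n 1).
have evX n : form_eval 'X_n = xi 0 n by rewrite /= map_mpolyX mevalXU.
move=> pj; exists 1%N, 'X_i, 'X_j; rewrite !mevalXU; split=> //; split=> //.
by rewrite !evX divfK // -evX (form_eval_neq0 (X1 j)) // mevalXU.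
Qed.

Lemma residue_poly (u : {poly k}) a c :
  residue a c -> residue (map_poly iota u).[a] u.[c].
Proof.
move=> rac; elim/poly_ind: u => [|u e IHu].
  by rewrite map_poly0 !horner0 -(rmorph0 iota); apply: residueC.
rewrite rmorphD rmorphM /= map_polyX map_polyC !hornerMXaddC.
by apply: residueD (residueC e); apply: residueM.
Qed.

Lemma local_ring_mul a b : local_ring iota xi p a -> local_ring iota xi p b ->
  local_ring iota xi p (a * b).
Proof.
by move=> /local_residue[c ra] /local_residue[e rb]; apply: residue_local (residueM ra rb).
Qed.

Lemma local_ring_add a b : local_ring iota xi p a -> local_ring iota xi p b ->
  local_ring iota xi p (a + b).
Proof.
by move=> /local_residue[c ra] /local_residue[e rb]; apply: residue_local (residueD ra rb).
Qed.

End Residues.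

End FermatFunctionField.

(** * Regular differentials *)
Section CurvePoints.

Variables (k : fieldType) (l : nat).
Hypothesis l_gt0 : (0 < l)%N.

Lemma on_fermatP (p : 'rV[k]_3) :
  on_curve (fermat k l) p <-> p != 0 /\ p 0 1 ^+ l = p 0 0 ^+ l + p 0 2 ^+ l.
Proof.
rewrite /on_curve mevalB mevalD !rmorphXn /= !mevalXU.
split=> -[p0 e]; split=> //; first exact/subr0_eq.
by rewrite e subrr.
Qed.

Lemma row3_eq0 (p : 'rV[k]_3) : p 0 0 = 0 -> p 0 1 = 0 -> p 0 2 = 0 -> p = 0.
Proof.
move=> p0 p1 p2; apply/rowP => i; rewrite mxE.
have /or3P[] : [|| i == 0, i == 1 | i == 2] by case: i => [[|[|[|]]]].
- by move/eqP->.
- by move/eqP->.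
- by move/eqP->.
Qed.

Lemma two_nonzero_coordinates (p : 'rV[k]_3) : on_curve (fermat k l) p ->
  [\/ p 0 0 != 0 /\ p 0 1 != 0, p 0 0 != 0 /\ p 0 2 != 0
    | p 0 1 != 0 /\ p 0 2 != 0].
Proof.
move=> /on_fermatP[p0 e].
have z0 : 0 ^+ l = 0 :> k by rewrite expr0n gtn_eqF.
have pow0 (a : k) : a ^+ l = 0 -> a = 0 by move/eqP; rewrite expf_eq0 l_gt0 => /eqP.
have [p00|p00] := eqVneq (p 0 0) 0.
  have [p01|p01] := eqVneq (p 0 1) 0.
    case/eqP: p0; apply: row3_eq0 => //; apply: pow0.
    by move: e; rewrite p00 p01 z0 add0r.
  apply: Or33; split=> //; apply: contra_eq_neq e => ->.
  by rewrite p00 z0 addr0 expf_neq0.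
have [p01|p01] := eqVneq (p 0 1) 0; last by apply: Or31.
apply: Or32; split=> //; apply: contra_eq_neq e => ->.
by rewrite p01 z0 addr0 eq_sym expf_neq0.
Qed.

End CurvePoints.

Section RegularDifferentials.

Variables (k K : fieldType) (iota : {rmorphism k -> K}) (e : nat) (x y : K).
Local Notation l := e.+3.
Hypotheses (l_neq0 : (l%:R : k) != 0) (hK : fermat_field iota l x y).
Variable D : K -> K.
Hypotheses (hD : derivation iota D) (Dx : D x = y ^+ e.+2) (Dy : D y = x ^+ e.+2).

Local Notation F := (fermat k l).
Local Notation xi := (generic_point x y).
Let l_gt0 : (0 < l)%N. Proof. by []. Qed.
Let curve_eq : y ^+ l = x ^+ l + 1. Proof. by case: hK. Qed.
Let x0 : x != 0. Proof. exact: fermat_x_neq0 hK. Qed.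
Let y0 : y != 0. Proof. exact: fermat_y_neq0 hK. Qed.

Lemma pairing_proportional D' : derivation iota D' ->
  exists t, forall w, pairing D' w = t * pairing D w.
Proof.
have lK : (l%:R : K) != 0 by rewrite -(rmorph_nat iota) fmorph_eq0.
move=> hD'; have [t tE] := derivation_unique l_gt0 hK lK hD hD' Dx Dy.
exists t => w; rewrite /pairing mulr_sumr; apply: eq_bigr => u _.
by rewrite tE mulrCA.
Qed.

(** Since D spans the derivations, a differential w is determined by its pairing
    with D: it equals (pairing D w) dx / y^(l-1). *)
Lemma eq_diffP w w' : eq_diff iota w w' <-> pairing D w = pairing D w'.
Proof.
split=> [|e0 D' /pairing_proportional[t tE]]; first exact.
by rewrite !tE e0.
Qed.

Section AtPoint.

Variable p : 'rV[k]_3.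
Hypothesis Cp : on_curve F p.

Local Notation local := (local_ring iota xi p).

Let localC c : local (iota c).
Proof. exact: (residue_local l_gt0 hK Cp (residueC _ _ _ _ _)). Qed.

Let localM a b : local a -> local b -> local (a * b).
Proof. exact: (local_ring_mul l_gt0 hK Cp). Qed.

Let localD a b : local a -> local b -> local (a + b).
Proof. exact: (local_ring_add l_gt0 hK Cp). Qed.

Let localN a : local a -> local (- a).
Proof. by move=> la; rewrite -mulN1r -(rmorph1 iota) -rmorphN; apply: localM. Qed.

Let localX a n : local a -> local (a ^+ n).
Proof.
move=> la; elim: n => [|n IHn]; first by rewrite expr0 -(rmorph1 iota).
by rewrite exprS; apply: localM.
Qed.

Let local_ratio (i j : 'I_3) : p 0 j != 0 -> local (xi 0 i / xi 0 j).
Proof.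
by move=> pj; apply: (residue_local l_gt0 hK Cp (residue_ratio l_gt0 hK Cp _ pj)).
Qed.

Let xiE : (xi 0 0 = x) * (xi 0 1 = y) * (xi 0 2 = 1).
Proof. by rewrite !mxE. Qed.

(** L is one of x and y, nonzero at p.  Such an L exists at each point: if X = Y = 0
    on the curve, then Z = 0. *)
Section Chart.

Variable j : 'I_3.
Hypotheses (pj : p 0 j != 0) (j2 : j != 2).
Local Notation L := (xi 0 j).

Let L_neq0 : L != 0.
Proof.
rewrite mxE; move: j2; have /or3P[] : [|| j == 0, j == 1 | j == 2].
- by case: (j) => [[|[|[|]]]].
- by move/eqP->.
- by move/eqP->.
- by move=> ->.
Qed.

(** The functions of the local ring whose derivative is L^e times one of them.  They
    are closed under the ring operations and under inverses of units, and contain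
    the ratios of coordinates. *)
Let good g := local g /\ local (D g / L ^+ e).

Let goodC c : good (iota c).
Proof.
have [_ _ Dc] := hD; split=> //.
by rewrite Dc mul0r -(rmorph0 iota).
Qed.

Let goodD a b : good a -> good b -> good (a + b).
Proof.
have [DD _ _] := hD; move=> [la la'] [lb lb']; split; first exact: localD.
by rewrite DD mulrDl; apply: localD.
Qed.

Let goodM a b : good a -> good b -> good (a * b).
Proof.
have [_ DM _] := hD; move=> [la la'] [lb lb']; split; first exact: localM.
rewrite DM mulrDl -mulrA mulrAC; apply: localD; exact: localM.
Qed.

Let goodX a n : good a -> good (a ^+ n).
Proof.
move=> ga; elim: n => [|n IHn]; first by rewrite expr0 -(rmorph1 iota).
by rewrite exprS; apply: goodM.
Qed.

Let goodV a : good a -> local a^-1 -> good a^-1.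
Proof.
move=> [la la'] lV; split=> //; rewrite (derivationV hD).
have -> : - D a / a ^+ 2 / L ^+ e = - (D a / L ^+ e * (a^-1 * a^-1)).
  by rewrite -invfM -expr2; ring.
by apply: localN; apply: localM => //; apply: localM.
Qed.

(** For L = x one has D (y/x) = (x^l - y^l) / x^2 = - x^e (1/x)^(e+2) and
    D (1/x) = - x^e (y/x)^(e+2); the case L = y is symmetric. *)
Let good_ratio i : good (xi 0 i / L).
Proof.
split; first exact: local_ratio.
have [_ DM _] := hD; have D1 := derivation1 hD.
have local0 : local 0 by rewrite -(rmorph0 iota).
have DV a b : D (a / b) = a * (- D b / b ^+ 2) + D a / b.
  by rewrite DM (derivationV hD).
have ce : y * (y * (y * y ^+ e)) = x * (x * (x * x ^+ e)) + 1.
  by have := curve_eq; rewrite !exprS.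
have xe0 : x ^+ e != 0 by rewrite expf_neq0.
have ye0 : y ^+ e != 0 by rewrite expf_neq0.
have i012 : [|| i == 0, i == 1 | i == 2] by case: (i) => [[|[|[|]]]].
have /orP[] : (j == 0) || (j == 1).
- by move: j2; case: (j) => [[|[|[|]]]].
- move=> /eqP j0; have pj0 := pj; rewrite j0 in pj0 *.
  have [ly lz] := (local_ratio 1 pj0, local_ratio 2 pj0); rewrite !xiE in ly lz.
  case/or3P: i012 => /eqP->; rewrite !xiE.
  + by rewrite mulfV // D1 mul0r.
  + have -> : D (y / x) / x ^+ e = - (1 / x) ^+ e.+2.
      rewrite DV Dx Dy expr_div_n expr1n !exprS.
      rewrite (_ : _ / _ = - (y * (y * (y * y ^+ e)) - x * (x * (x * x ^+ e)))
                           / (x * (x * x ^+ e))).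
        by rewrite ce; field; rewrite ?x0 ?xe0 ?y0 ?ye0.
      by field; rewrite ?x0 ?xe0 ?y0 ?ye0.
    by apply: localN; apply: localX.
  + have -> : D (1 / x) / x ^+ e = - (y / x) ^+ e.+2.
      rewrite DV D1 Dx expr_div_n !exprS; field; rewrite x0 xe0 //.
    by apply: localN; apply: localX.
- move=> /eqP j0; have pj0 := pj; rewrite j0 in pj0 *.
  have [ly lz] := (local_ratio 0 pj0, local_ratio 2 pj0); rewrite !xiE in ly lz.
  case/or3P: i012 => /eqP->; rewrite !xiE.
  + have -> : D (x / y) / y ^+ e = (1 / y) ^+ e.+2.
      rewrite DV Dx Dy expr_div_n expr1n !exprS.
      rewrite (_ : _ / _ = (y * (y * (y * y ^+ e)) - x * (x * (x * x ^+ e)))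
                           / (y * (y * y ^+ e))).
        by rewrite ce; field; rewrite ?x0 ?xe0 ?y0 ?ye0.
      by field; rewrite ?x0 ?xe0 ?y0 ?ye0.
    by apply: localX.
  + by rewrite mulfV // D1 mul0r.
  + have -> : D (1 / y) / y ^+ e = - (x / y) ^+ e.+2.
      rewrite DV D1 Dy expr_div_n !exprS; field; rewrite y0 ye0 //.
    by apply: localN; apply: localX.
Qed.

Let good_form d G : G \is d.-homog -> good (form_eval iota x y G / L ^+ d).
Proof.
apply: (homog_ind (P := fun G => good (form_eval iota x y G / L ^+ d)))
  => {G} [|G H gG gH|c a b f <-].
- by rewrite rmorph0 mul0r -(rmorph0 iota).
- by rewrite rmorphD mulrDl; apply: goodD.
rewrite form_eval_Z !rmorphM !rmorphXn form_eval_X0 form_eval_X1 form_eval_X2.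
have -> : iota c * (x ^+ a * y ^+ b * 1 ^+ f) / L ^+ (a + b + f)
    = iota c * ((xi 0 0 / L) ^+ a * (xi 0 1 / L) ^+ b * (xi 0 2 / L) ^+ f).
  rewrite !xiE !expr_div_n !exprD; field.
  by rewrite !expf_neq0.
by apply: goodM => //; apply: goodM; [apply: goodM|]; apply: goodX.
Qed.

Let residue_form d G : G \is d.-homog ->
  residue iota x y p (form_eval iota x y G / L ^+ d) (G.@[p 0] / p 0 j ^+ d).
Proof.
move=> hG; exists d, G, ('X_j ^+ d); rewrite !rmorphXn /= !mevalXU expf_neq0 //.
by split; rewrite ?homogX // map_mpolyX mevalXU divfK // expf_neq0.
Qed.

(** A function G / H of the local ring is a quotient of polynomials in the ratios of
    coordinates to L, obtained by dividing G and H by L^d. *)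
Lemma local_ring_derivative g : local g -> local (D g / L ^+ e).
Proof.
suff: local g -> good g by move=> H /H[].
move=> [d [G [H [hG hH Hp ->]]]]; rewrite !form_evalE.
have Ld : L ^+ d != 0 by rewrite expf_neq0.
have -> : form_eval iota x y G / form_eval iota x y H
    = (form_eval iota x y G / L ^+ d) * (form_eval iota x y H / L ^+ d)^-1.
  by rewrite invf_div mulrA divfK.
apply: goodM; first exact: good_form.
apply: goodV; first exact: good_form.
apply: (residue_local l_gt0 hK Cp (residueV l_gt0 hK Cp (residue_form hH) _)).
by rewrite mulf_neq0 // invr_eq0 expf_neq0.
Qed.

Lemma regular_pairing w : regular_at iota xi p w -> local (pairing D w / L ^+ e).
Proof.
move=> [w' /eq_diffP-> loc]; rewrite /pairing mulr_suml big_seq.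
apply: big_ind => [||u /loc[lu1 lu2]]; first by rewrite -(rmorph0 iota).
  exact: localD.
by rewrite -mulrA; apply: localM => //; apply: local_ring_derivative.
Qed.

End Chart.

(** The same differential is x^a y^b dx / y^(e+2), x^a y^b dy / x^(e+2) and
    - (x^(a+2) y^b / y^(e+2)) d(1/x); a point of the curve has at least two nonzero
    coordinates, and one of the three expressions is regular there. *)
Lemma regular_monomial a b : (a + b <= e)%N ->
  regular_at iota xi p [:: (x ^+ a * y ^+ b / y ^+ e.+2, x)].
Proof.
move=> le_ab.
have x20 : x ^+ e.+2 != 0 by rewrite expf_neq0.
have y20 : y ^+ e.+2 != 0 by rewrite expf_neq0.
have wE : pairing D [:: (x ^+ a * y ^+ b / y ^+ e.+2, x)] = x ^+ a * y ^+ b.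
  by rewrite /pairing big_seq1 /= Dx divfK.
have ratio := local_ratio.
case: (two_nonzero_coordinates l_gt0 Cp) => -[p1 p2].
- exists [:: (- ((x / y) ^+ a.+2 * (1 / y) ^+ (e - (a + b))), 1 / x)].
    apply/eq_diffP; rewrite wE /pairing big_seq1 /= !div1r (derivationV hD) Dx.
    rewrite exprVn.
    have -> : y ^+ e.+2 = y * (y * (y ^+ a * y ^+ b * y ^+ (e - (a + b)))).
      by rewrite !exprS -!exprD subnKC.
    rewrite expr_div_n !exprS; field.
    by rewrite ?x0 ?y0 ?expf_neq0.
  move=> u; rewrite inE => /eqP->; split=> /=; last first.
    by have := ratio 2 _ p1; rewrite !xiE.
  apply: localN; apply: localM; apply: localX.
    by have := ratio 0 _ p2; rewrite !xiE.
  by have := ratio 2 _ p2; rewrite !xiE.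
- exists [:: (x ^+ a * y ^+ b * (1 / x) ^+ e.+2, y)].
    apply/eq_diffP; rewrite wE /pairing big_seq1 /= Dy expr_div_n expr1n.
    by rewrite -mulrA divfK ?mulr1.
  have lx : local x by have := ratio 0 _ p2; rewrite !xiE divr1.
  have ly : local y by have := ratio 1 _ p2; rewrite !xiE divr1.
  move=> u; rewrite inE => /eqP->; split=> //=.
  apply: localM; first by apply: localM; apply: localX.
  by apply: localX; have := ratio 2 _ p1; rewrite !xiE.
- exists [:: (x ^+ a * y ^+ b * (1 / y) ^+ e.+2, x)].
    apply/eq_diffP; rewrite wE /pairing big_seq1 /= Dx expr_div_n expr1n.
    by rewrite -mulrA divfK ?mulr1.
  have lx : local x by have := ratio 0 _ p2; rewrite !xiE divr1.
  have ly : local y by have := ratio 1 _ p2; rewrite !xiE divr1.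
  move=> u; rewrite inE => /eqP->; split=> //=.
  apply: localM; first by apply: localM; apply: localX.
  by apply: localX; have := ratio 2 _ p1; rewrite !xiE.
Qed.

End AtPoint.

End RegularDifferentials.

(** * Global sections of O(e) *)

(** The derivative l X^(l-1) vanishes only at 0. *)
Lemma simple_root (k : fieldType) (l : nat) (z : k) :
  (l%:R : k) != 0 -> z ^+ l = -1 ->
  exists w, 'X^l + 1 = w * ('X - z%:P) /\ w.[z] != 0.
Proof.
move=> l0 zl; have /factor_theorem[w wE] : root ('X^l + 1) z.
  by rewrite rootE !hornerE zl addNr.
exists w; split=> //; apply/eqP => w0.
have lgt0 : (0 < l)%N by case: l l0 {zl wE} => //; rewrite eqxx.
have := congr1 (fun u : {poly k} => (u^`()).[z]) wE.
rewrite derivM !derivE !hornerE w0 subrr mulr0 add0r => /eqP.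
rewrite hornerMn hornerXn -mulr_natl mulf_eq0 (negPf l0) /= expf_eq0.
case/andP=> _ /eqP z0; move: zl; rewrite z0 expr0n gtn_eqF //=.
by move/esym/eqP; rewrite oppr_eq0 oner_eq0.
Qed.

Lemma exists_root (k : closedFieldType) (n : nat) (a : k) :
  (0 < n)%N -> exists b, b ^+ n = a.
Proof.
move=> n0; have /closed_rootP[b] : size ('X^n - a%:P) != 1 by rewrite size_XnsubC // eqSS -lt0n.
by rewrite rootE !hornerE subr_eq0 => /eqP; exists b.
Qed.

Lemma exists_primitive_root (k : closedFieldType) (l : nat) :
  (l%:R : k) != 0 -> exists z : k, l.-primitive_root z.
Proof.
move=> l0; have lgt0 : (0 < l)%N by case: l l0 => //; rewrite eqxx.
have [rs rsE] := closed_field_poly_normal ('X^l - 1 : {poly k}).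
have lc1 : lead_coef ('X^l - 1 : {poly k}) = 1.
  by apply/eqP; rewrite -polyC1 -monicE monicXnsubC.
rewrite lc1 scale1r in rsE.
have /hasP[z _ ?] : has l.-primitive_root rs; last by exists z.
apply: has_prim_root => //.
- by apply/allP => z zrs; rewrite /root_of_unity rsE root_prod_XsubC.
- by rewrite -separable_prod_XsubC -rsE; apply: separable_Xn_sub_1.
- by rewrite -ltnS -(size_prod_XsubC rs id) -rsE -polyC1 size_XnsubC.
Qed.

Section GlobalSections.

Variables (k : closedFieldType) (K : fieldType) (iota : {rmorphism k -> K}).
Variables (e : nat) (x y : K).
Local Notation l := e.+3.
Hypotheses (l_neq0 : (l%:R : k) != 0) (hK : fermat_field iota l x y).

Local Notation F := (fermat k l).
Local Notation xi := (generic_point x y).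
Local Notation local := (local_ring iota xi).
Let l_gt0 : (0 < l)%N. Proof. by []. Qed.
Let curve_eq : y ^+ l = x ^+ l + 1. Proof. by case: hK. Qed.
Let x0 : x != 0. Proof. exact: fermat_x_neq0 hK. Qed.
Let y0 : y != 0. Proof. exact: fermat_y_neq0 hK. Qed.
Let xiE : (xi 0 0 = x) * (xi 0 1 = y) * (xi 0 2 = 1).
Proof. by rewrite !mxE. Qed.
Local Notation evx u := (map_poly iota u).[x].

(** phi is a section of O(e), trivialized by Z^e on the affine part: phi Z^e / L^e
    is a regular function at p for every coordinate L nonzero at p.  At each
    point X or Y is nonzero. *)
Definition global_section (phi : K) : Prop :=
  forall (p : 'rV[k]_3) (j : 'I_3), on_curve F p -> p 0 j != 0 -> j != 2 ->
    local p (phi / xi 0 j ^+ e).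

Lemma global_sectionD phi psi : global_section phi -> global_section psi ->
  global_section (phi + psi).
Proof.
move=> sphi spsi p j Cp pj j2; rewrite mulrDl.
by apply: (local_ring_add l_gt0 hK Cp); [apply: sphi|apply: spsi].
Qed.

Lemma global_sectionZ c phi : global_section phi -> global_section (iota c * phi).
Proof.
move=> sphi p j Cp pj j2; rewrite -mulrA; apply: (local_ring_mul l_gt0 hK Cp).
  exact: (residue_local l_gt0 hK Cp (residueC _ _ _ _ _)).
exact: sphi.
Qed.

Lemma global_section0 : global_section 0.
Proof.
move=> p j Cp pj j2; rewrite mul0r -(rmorph0 iota).
exact: (residue_local l_gt0 hK Cp (residueC _ _ _ _ _)).
Qed.

Definition twist (z : k) (p : 'rV[k]_3) : 'rV[k]_3 :=
  \row_i (if i == 1 then z * p 0 i else p 0 i).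

Lemma twist_on_curve z p : z ^+ l = 1 -> on_curve F p -> on_curve F (twist z p).
Proof.
move=> zl /on_fermatP[p0 pE]; apply/on_fermatP; rewrite !mxE /=.
split; last by rewrite exprMn zl mul1r.
apply: contraNneq p0 => t0.
have z0 : z != 0 by apply: contra_eq_neq zl => ->; rewrite expr0n /= eq_sym oner_eq0.
have t i : twist z p 0 i = 0 by rewrite t0 mxE.
apply/eqP/row3_eq0.
- by have := t 0; rewrite mxE.
- by have /eqP := t 1; rewrite mxE /= mulf_eq0 (negPf z0) => /eqP.
- by have := t 2; rewrite mxE.
Qed.

Section Automorphism.

Variables (z : k) (sigma : {rmorphism K -> K}).
Hypotheses (zl : z ^+ l = 1) (sC : forall c, sigma (iota c) = iota c)
  (sx : sigma x = x) (sy : sigma y = iota z * y).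

Let z_neq0 : z != 0.
Proof. by apply: contra_eq_neq zl => ->; rewrite expr0n /= eq_sym oner_eq0. Qed.

(** sigma acts on values of forms through the substitution of z Y for Y. *)
Lemma twist_form d G (p : 'rV[k]_3) : G \is d.-homog -> exists G',
  [/\ G' \is d.-homog, sigma (form_eval iota x y G) = form_eval iota x y G'
    & G'.@[p 0] = G.@[twist z p 0]].
Proof.
apply: (homog_ind (P := fun G => exists G',
  [/\ G' \is d.-homog, sigma (form_eval iota x y G) = form_eval iota x y G'
    & G'.@[p 0] = G.@[twist z p 0]])) => {G} [|G H|c a b f <-].
- by exists 0; rewrite !rmorph0 rpred0.
- move=> [G' [hG' sG' G'p]] [H' [hH' sH' H'p]]; exists (G' + H').
  by rewrite rpredD // !rmorphD /= sG' sH' G'p H'p.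
exists ((c * z ^+ b) *: ('X_0 ^+ a * 'X_1 ^+ b * 'X_2 ^+ f)); split.
- by rewrite rpredZ // !dhomogM ?homogX.
- rewrite !form_eval_Z !rmorphM sC !rmorphXn form_eval_X0 form_eval_X1 form_eval_X2 sx sy rmorph1.
  by rewrite exprMn; ring.
- rewrite !mevalZ !mevalM !rmorphXn /= !mevalXU !mxE /= exprMn.
  by ring.
Qed.

Lemma twist_local p a : local (twist z p) a -> local p (sigma a).
Proof.
move=> [d [G [H [hG hH Hp ->]]]]; rewrite fmorph_div.
have [G' [hG' -> G'p]] := twist_form p hG.
have [H' [hH' -> H'p]] := twist_form p hH.
by exists d, G', H'; rewrite H'p.
Qed.

Lemma global_section_sigma phi : global_section phi -> global_section (sigma phi).
Proof.
move=> sphi p j Cp pj j2.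
have tj : twist z p 0 j != 0 by rewrite mxE; case: (j == 1); rewrite ?mulf_neq0.
have /twist_local := sphi _ _ (twist_on_curve zl Cp) tj j2.
rewrite fmorph_div rmorphXn.
have [c [c0 ->]] : exists c, c != 0 /\ sigma (xi 0 j) = iota c * xi 0 j.
  move: j2; have /or3P[] : [|| j == 0, j == 1 | j == 2] by case: (j) => [[|[|[|]]]].
  - by move=> /eqP-> _; exists 1; rewrite oner_eq0 xiE rmorph1 mul1r.
  - by move=> /eqP-> _; exists z; rewrite xiE.
  - by move=> ->.
have -> : sigma phi / xi 0 j ^+ e
    = iota (c ^+ e) * (sigma phi / (iota c * xi 0 j) ^+ e).
  rewrite exprMn invfM rmorphXn [RHS]mulrCA mulVKf //.
  by rewrite expf_neq0 // fmorph_eq0.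
move=> loc; apply: (local_ring_mul l_gt0 hK Cp) loc.
exact: (residue_local l_gt0 hK Cp (residueC _ _ _ _ _)).
Qed.

End Automorphism.

(** The sum over j of z^(-j m) sigma_j(phi), where sigma_j maps y to z^j y and z is a
    primitive l-th root of unity, is l times the component of phi in y^m. *)
Lemma global_section_component (r : 'I_l -> K) :
  (forall i, exists u v : {poly k}, r i = evx u / evx v) ->
  global_section (\sum_i r i * y ^+ i) ->
  forall i, global_section (r i * y ^+ i).
Proof.
move=> r_frac sphi m; have [z zprim] := exists_primitive_root l_neq0.
set phi := \sum_i _ in sphi.
have z0 : z != 0.
  apply: contra_eq_neq (prim_expr_order zprim) => ->.
  by rewrite expr0n /= eq_sym oner_eq0.
have zjl j : (z ^+ j) ^+ l = 1 by rewrite exprAC (prim_expr_order zprim) expr1n.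
have twisted (j : 'I_l) :
    global_section (\sum_(i < l) iota (z ^+ (j * i)) * (r i * y ^+ i)).
  have [sigma [sC sx sy]] := fermat_automorphism l_gt0 hK (zjl j).
  have := global_section_sigma (zjl j) sC sx sy sphi; rewrite rmorph_sum.
  have sev u : sigma (evx u) = evx u.
    rewrite -horner_map -map_poly_comp sx; congr (_.[x]).
    by apply: eq_map_poly => c; apply: sC.
  under eq_bigr => i _.
    have [u [v rE]] := r_frac i.
    rewrite rmorphM rmorphXn sy exprMn -rmorphXn -exprM.
    rewrite (_ : sigma (r i) = r i); last by rewrite rE fmorph_div !sev.
    rewrite mulrCA; over.
  by [].
have lK : (l%:R : K) != 0 by rewrite -(rmorph_nat iota) fmorph_eq0.
have -> : r m * y ^+ m = iota l%:R^-1 *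
    \sum_(j < l) iota ((z ^+ (j * m))^-1) *
       \sum_(i < l) iota (z ^+ (j * i)) * (r i * y ^+ i).
  under eq_bigr do rewrite mulr_sumr.
  rewrite exchange_big (bigD1 m) //= [X in _ * (_ + X)]big1 ?addr0.
    under eq_bigr do rewrite mulrA -rmorphM mulVf ?expf_neq0 // rmorph1 mul1r.
    by rewrite sumr_const card_ord fmorphV rmorph_nat -[(_ * _) *+ _]mulr_natl mulKf.
  move=> i im; under eq_bigr do rewrite mulrA -rmorphM.
  rewrite -mulr_suml -rmorph_sum.
  rewrite (_ : \sum_(j < l) _ = 0) ?rmorph0 ?mul0r //.
  pose w := z ^+ i / z ^+ m.
  have w1 : w != 1.
    rewrite -subr_eq0 -(mulIr_eq0 _ (mulIf (expf_neq0 m z0))) mulrBl mul1r divfK ?expf_neq0 //.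
    rewrite subr_eq0 (eq_prim_root_expr zprim) !modn_small //.
  have := subrX1 w l; rewrite expr_div_n -!exprM ![(_ * l)%N]mulnC !exprM.
  rewrite (prim_expr_order zprim) !expr1n divr1 subrr => /esym/eqP.
  rewrite mulf_eq0 subr_eq0 (negPf w1) /= => /eqP {2}<-.
  apply: eq_bigr => j _.
  by rewrite /w expr_div_n -!exprM ![(_ * j)%N]mulnC mulrC.
apply: global_sectionZ; apply: big_ind => [||j _].
- exact: global_section0.
- exact: global_sectionD.
- exact: global_sectionZ.
Qed.

Lemma fraction_coprime (u v : {poly k}) : v != 0 ->
  exists u' v' : {poly k}, [/\ v' != 0, coprimep u' v' & evx u / evx v = evx u' / evx v'].
Proof.
move=> v0; pose g := gcdp u v.
have g0 : g != 0 by rewrite gcdp_eq0 negb_and v0 orbT.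
have evx0 w : w != 0 -> evx w != 0.
  by move=> w0; apply: contra_neq w0; apply: (evx_eq0 l_gt0 hK).
have uE := divpK (dvdp_gcdl u v); have vE := divpK (dvdp_gcdr u v).
exists (u %/ g), (v %/ g).
have v'0 : v %/ g != 0 by apply: contraNneq v0; rewrite -{2}vE -/g => ->; rewrite mul0r.
split=> //; first by rewrite coprimep_div_gcd // v0 orbT.
have evxE w : g %| w -> evx w = evx (w %/ g) * evx g.
  by move=> gw; rewrite -hornerM -rmorphM /= divpK.
rewrite (evxE u) ?dvdp_gcdl // (evxE v) ?dvdp_gcdr // -mulf_div mulfV ?evx0 //.
by rewrite mulr1.
Qed.

Let row3 (a b c : k) : 'rV[k]_3 :=
  \row_i (if i == 0 then a else if i == 1 then b else c).

Let row3E a b c : (row3 a b c 0 0 = a) * (row3 a b c 0 1 = b) * (row3 a b c 0 2 = c).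
Proof. by rewrite !mxE. Qed.

(** A root a of v would be a pole of phi at the points (a : b : 1), b^l = a^l + 1.
    If b <> 0, the identity phi v = u y^i evaluates to 0 = u(a) b^i.  If b = 0,
    then x^l + 1 = (x - a) w with w(a) <> 0, and the l-th power of the identity,
    divided by (x - a)^i, still has a factor (x - a)^(l-i) on the side of phi. *)
Lemma global_section_integral (u v : {poly k}) (i : 'I_l) :
  v != 0 -> coprimep u v -> global_section (evx u / evx v * y ^+ i) -> size v = 1.
Proof.
move=> v0 cuv; set phi := _ * _ => sphi.
have evx0 w : w != 0 -> evx w != 0.
  by move=> w0; apply: contra_neq w0; apply: (evx_eq0 l_gt0 hK).
apply/eqP; apply: contraT => /closed_rootP[a va].
have ua : u.[a] != 0.
  by apply: (coprimep_root (p := v)); rewrite // coprimep_sym.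
have [b bE] := exists_root (a ^+ l + 1) l_gt0.
pose p := row3 a b 1.
have Cp : on_curve F p.
  apply/on_fermatP; rewrite !row3E expr1n; split=> //.
  apply/eqP => /rowP/(_ 2); rewrite mxE [RHS]mxE /= => /eqP.
  by rewrite oner_eq0.
have p2 : p 0 2 != 0 by rewrite row3E oner_eq0.
have rx : residue iota x y p x a.
  by have := residue_ratio l_gt0 hK Cp 0 p2; rewrite !xiE !row3E !divr1.
have ry : residue iota x y p y b.
  by have := residue_ratio l_gt0 hK Cp 1 p2; rewrite !xiE !row3E !divr1.
have [c rc] : exists c, residue iota x y p phi c.
  apply: (local_residue l_gt0 hK Cp).
  have [j [pj j2 L0]] : exists j : 'I_3, [/\ p 0 j != 0, j != 2 & xi 0 j != 0].
    have [a0|a0] := eqVneq a 0; last by exists 0; rewrite row3E xiE.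
    exists 1; rewrite row3E xiE; split=> //.
    by apply: contra_eq_neq bE => ->; rewrite a0 !expr0n /= add0r eq_sym oner_eq0.
  have -> : phi = phi / xi 0 j ^+ e * xi 0 j ^+ e by rewrite divfK // expf_neq0.
  apply: (local_ring_mul l_gt0 hK Cp); first exact: sphi.
  have rj : residue iota x y p (xi 0 j) (p 0 j / p 0 2).
    by have := residue_ratio l_gt0 hK Cp j p2; rewrite [xi 0 2]xiE divr1.
  exact: (residue_local l_gt0 hK Cp (residueX e rj)).
have phiE : phi * evx v = evx u * y ^+ i.
  by rewrite mulrAC divfK // evx0.
clearbody phi.
have rpoly w := residue_poly w rx.
have [al|al] := eqVneq (a ^+ l) (-1); last first.
  have b0 : b != 0.
    apply: contra_eq_neq bE => ->; rewrite -addr_eq0 in al.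
    by rewrite [0 ^+ _]expr0n eq_sym.
  have := residueM rc (rpoly v); rewrite phiE => r1.
  have := residue_uniq l_gt0 hK Cp r1 (residueM (rpoly u) (residueX i ry)).
  by rewrite (rootP va) mulr0 => /esym/eqP; rewrite mulf_eq0 expf_eq0 (negPf ua) (negPf b0) andbF.
have [w [wE wa]] := simple_root l_neq0 al.
have /factor_theorem[v1 v1E] := va.
pose t := evx ('X - a%:P).
have t0 : t != 0 by rewrite evx0 // polyXsubC_eq0.
have rt : residue iota x y p t 0 by have := rpoly ('X - a%:P); rewrite !hornerE subrr.
have phil : phi ^+ l * evx v1 ^+ l * t ^+ (l - i) = evx u ^+ l * evx w ^+ i.
  have ti0 : t ^+ i != 0 by rewrite expf_neq0.
  apply: (mulIf ti0); rewrite -[LHS]mulrA -exprD subnK; last exact: ltnW.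
  have vE : evx v = evx v1 * t by rewrite v1E rmorphM hornerM.
  have ylE : y ^+ l = evx w * t.
    rewrite curve_eq -[evx w * t]hornerM -rmorphM -wE rmorphD rmorph1 /=.
    by rewrite map_polyXn hornerD hornerXn hornerC.
  transitivity ((phi * evx v) ^+ l); first by rewrite vE !exprMn mulrA.
  by rewrite phiE exprMn -exprM mulnC exprM ylE exprMn mulrA.
have := residueM (residueM (residueX l rc) (residueX l (rpoly v1))) (residueX (l - i) rt).
rewrite phil => r1.
have := residue_uniq l_gt0 hK Cp r1 (residueM (residueX l (rpoly u)) (residueX i (rpoly w))).
rewrite expr0n subn_eq0 leqNgt ltn_ord mulr0 => /esym/eqP.
by rewrite mulf_eq0 !expf_eq0 (negPf ua) (negPf wa) !andbF.
Qed.

(** At the point (1 : 1 : 0) the function 1/x vanishes, and c(x) = x^D rev(1/x) where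
    D is the degree of c and rev the reciprocal polynomial, with
    rev(0) = lead_coef c <> 0; so D + i > e would give a pole of phi / x^e. *)
Lemma global_section_degree (c : {poly k}) (i : 'I_l) :
  global_section (evx c * y ^+ i) -> (size c <= e.+1 - i)%N.
Proof.
move=> sphi; rewrite leqNgt; apply/negP => szc.
have c0 : c != 0 by apply: contraTneq szc => ->; rewrite size_poly0.
pose p := row3 1 1 0.
have Cp : on_curve F p.
  apply/on_fermatP; rewrite !row3E expr0n /= addr0; split=> //.
  apply/eqP => /rowP/(_ 0); rewrite mxE [RHS]mxE /= => /eqP.
  by rewrite oner_eq0.
have p0 : p 0 0 != 0 by rewrite row3E oner_eq0.
have p1 : p 0 1 != 0 by rewrite row3E oner_eq0.
have rxy : residue iota x y p (x / y) 1.
  by have := residue_ratio l_gt0 hK Cp 0 p1; rewrite !xiE !row3E !divr1.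
have rxV : residue iota x y p (1 / x) 0.
  by have := residue_ratio l_gt0 hK Cp 2 p0; rewrite !xiE !row3E mul0r.
have [d rd] := local_residue l_gt0 hK Cp (sphi p 0 Cp p0 isT).
pose D := (size c).-1.
have szcE : size c = D.+1 by rewrite prednK // size_poly_gt0.
pose rev := \sum_(j < D.+1) c`_j *: 'X^(D - j) : {poly k}.
have rev0 : rev.[0] = lead_coef c.
  rewrite horner_sum big_ord_recr /= subnn hornerZ hornerXn mulr1 big1 ?add0r //.
  by move=> j _; rewrite hornerZ hornerXn expr0n subn_eq0 leqNgt ltn_ord mulr0.
have revE : (map_poly iota rev).[1 / x] * x ^+ D = evx c.
  have szm : (size (map_poly iota c) <= D.+1)%N by rewrite -szcE size_poly.
  rewrite (horner_coef_wide x szm) rmorph_sum horner_sum mulr_suml.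
  apply: eq_bigr => j _; rewrite /= map_polyZ map_polyXn hornerZ hornerXn coef_map /=.
  have -> : x ^+ D = x ^+ (D - j) * x ^+ j by rewrite -exprD subnK // leq_ord.
  by rewrite -mulrA expr_div_n expr1n div1r mulKf // expf_neq0.
have key : (map_poly iota rev).[1 / x] =
    (evx c * y ^+ i / xi 0 0 ^+ e) * (x / y) ^+ i * (1 / x) ^+ (D + i - e).
  have le : (e <= D + i)%N by move: szc; rewrite szcE; lia.
  rewrite -revE xiE !expr_div_n expr1n.
  have xDi : x ^+ D * x ^+ i = x ^+ (D + i - e) * x ^+ e by rewrite -!exprD subnK.
  set R := (map_poly iota rev).[1 / x].
  transitivity (R * (x ^+ D * x ^+ i) / (x ^+ (D + i - e) * x ^+ e)).
    by rewrite xDi mulfK // mulf_neq0 // expf_neq0.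
  by field; rewrite !expf_neq0.
have := residueM (residueM rd (residueX i rxy)) (residueX (D + i - e) rxV).
rewrite -key => r1; have := residue_uniq l_gt0 hK Cp r1 (residue_poly rev rxV).
rewrite rev0 expr0n subn_eq0 leqNgt (_ : (e < D + i)%N); last first.
  by move: szc; rewrite szcE; lia.
by rewrite mulr0 => /esym/eqP; rewrite lead_coef_eq0 (negPf c0).
Qed.

Lemma global_section_form phi : global_section phi ->
  exists c : 'I_l -> {poly k},
    (forall i : 'I_l, (size (c i) <= e.+1 - i)%N) /\ phi = \sum_i evx (c i) * y ^+ i.
Proof.
have [_ _ /(_ phi)[u [v [v0 ->]]]] := hK => sphi.
have comp i : global_section (evx (u i) / evx (v i) * y ^+ i).
  apply: (global_section_component _ sphi) => j.
  by exists (u j), (v j).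
have /fin_all_exists[c cP] : forall i : 'I_l, exists c : {poly k},
    (size c <= e.+1 - i)%N /\ evx (u i) / evx (v i) = evx c.
  move=> i; have [u' [v' [v'0 cuv uvE]]] := fraction_coprime (u i) (v0 i).
  have si := comp i; rewrite uvE in si *.
  have /eqP/size_poly1P[a a0 v'E] := global_section_integral v'0 cuv si.
  have cE : evx u' / evx v' = evx (a^-1 *: u').
    by rewrite v'E map_polyC hornerC map_polyZ hornerZ fmorphV mulrC.
  exists (a^-1 *: u'); split=> //; apply: global_section_degree.
  by rewrite -cE.
exists c; split=> [i|]; first by case: (cP i).
by apply: eq_bigr => i _; case: (cP i) => _ ->.
Qed.

End GlobalSections.

(** * The genus and the smoothness of Fermat curves *)
Definition monomial_exponents e : {set 'I_e.+1 * 'I_e.+1} :=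
  [set ab : 'I_e.+1 * 'I_e.+1 | (ab.1 + ab.2 <= e)%N].

Lemma card_monomial_exponents e : #|monomial_exponents e| = 'C(e.+2, 2).
Proof.
rewrite -sum1_card -bin2_sum big_mkord big_ord_recl add0n.
rewrite (reindex_inj rev_ord_inj) /=.
transitivity (\sum_(a < e.+1) \sum_(b < e.+1 | (a + b <= e)%N) 1)%N.
  rewrite pair_big_dep /=; apply: eq_bigl => ab; by rewrite inE.
apply: eq_bigr => a _; rewrite sum1_card -[LHS]/(#|[pred b : 'I_e.+1 | (a + b <= e)%N]|).
rewrite /bump add1n subSS -[RHS]card_ord.
have le : ((e - a).+1 <= e.+1)%N by rewrite ltnS leq_subr.
rewrite -(card_image (f := widen_ord le)); last by move=> i j /(congr1 val) /= /val_inj.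
apply: eq_card => b; rewrite inE.
apply/idP/imageP => [le_ab|[b' _ ->] /=]; last by have := ltn_ord b'; have := ltn_ord a; lia.
have lt : (b < (e - a).+1)%N by lia.
by exists (Ordinal lt) => //; apply: val_inj.
Qed.

Section Genus.

Variables (k : closedFieldType) (K : fieldType) (iota : {rmorphism k -> K}).
Variables (e : nat) (x y : K).
Local Notation l := e.+3.
Hypotheses (l_neq0 : (l%:R : k) != 0) (hK : fermat_field iota l x y).

Local Notation F := (fermat k l).
Local Notation xi := (generic_point x y).
Local Notation A := (monomial_exponents e).
Local Notation evx u := (map_poly iota u).[x].
Let l_gt0 : (0 < l)%N. Proof. by []. Qed.
Let y0 : y != 0. Proof. exact: fermat_y_neq0 hK. Qed.

Definition basis_diff (m : 'I_#|A|) : differential K :=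
  let ab := enum_val m in [:: (x ^+ ab.1 * y ^+ ab.2 / y ^+ e.+2, x)].

Let ex (m : 'I_#|A|) : nat := (enum_val m).1.
Let ey (m : 'I_#|A|) : nat := (enum_val m).2.

Let exey m : (ex m + ey m <= e)%N.
Proof. by have := enum_valP m; rewrite inE. Qed.

Let exey_inj m m' : ex m = ex m' -> ey m = ey m' -> m = m'.
Proof.
rewrite /ex /ey => h1 h2; apply: enum_val_inj.
by case: (enum_val m) (enum_val m') h1 h2 => a b [a' b'] /= /val_inj-> /val_inj->.
Qed.

Let exey_surj a b : (a + b <= e)%N -> exists m, ex m = a /\ ey m = b.
Proof.
move=> le; have la : (a < e.+1)%N by lia.
have lb : (b < e.+1)%N by lia.
have inA : (Ordinal la, Ordinal lb) \in A by rewrite inE.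
by exists (enum_rank_in inA (Ordinal la, Ordinal lb)); rewrite /ex /ey enum_rankK_in.
Qed.

(** The coefficient of y^i in the pairing of the combination c of the basis. *)
Let row_poly (c : 'I_#|A| -> k) (i : nat) : {poly k} :=
  \sum_(m | ey m == i) c m *: 'X^(ex m).

Let row_polyE c m : (row_poly c (ey m))`_(ex m) = c m.
Proof.
rewrite coef_sum (bigD1 m) //= coefZ coefXn eqxx mulr1 big1 ?addr0 //.
move=> m' /andP[/eqP e1 mm']; rewrite coefZ coefXn; case: eqP => [e2|_]; last by rewrite mulr0.
by case/eqP: mm'; apply: exey_inj.
Qed.

Let row_poly0 c a i : (e < a + i)%N -> (row_poly c i)`_a = 0.
Proof.
move=> lt; rewrite coef_sum big1 // => m /eqP mi; rewrite coefZ coefXn.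
by case: eqP => [ma|_]; rewrite ?mulr0 //; have := exey m; lia.
Qed.

Let sum_row_poly c :
  \sum_m iota (c m) * (x ^+ ex m * y ^+ ey m) = \sum_(i < l) evx (row_poly c i) * y ^+ i.
Proof.
have lt m : (ey m < l)%N by have := exey m; lia.
rewrite (partition_big (fun m => Ordinal (lt m)) predT) //=; apply: eq_bigr => i _.
rewrite rmorph_sum horner_sum mulr_suml; apply: eq_big => [m|m /eqP <-].
  by rewrite -val_eqE.
by rewrite /= map_polyZ map_polyXn hornerZ hornerXn mulrA.
Qed.

(** In terms of pairings with D the basis consists of the monomials x^a y^b with
    a + b <= e: they are independent by the choice of K, and the pairing of a regular
    differential is a global section of O(e). *)
Lemma fermat_regular_basis : regular_basis iota F xi basis_diff.
Proof.
have [D [hD Dx Dy]] := fermat_derivation l_gt0 hK.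
have eq_diffD := eq_diffP l_neq0 hK hD Dx Dy.
have pair c : pairing D (lin_comb iota c basis_diff)
    = \sum_m iota (c m) * (x ^+ ex m * y ^+ ey m).
  rewrite /pairing big_flatten big_map big_enum; apply: eq_bigr => m _.
  by rewrite big_map big_seq1 /= Dx -mulrA divfK // expf_neq0.
split.
- move=> m p Cp; apply: (regular_monomial l_neq0 hK hD Dx Dy Cp); exact: exey.
- move=> c /eq_diffD; rewrite pair [RHS]big_nil sum_row_poly => c0 m.
  have [_ indep _] := hK.
  have lt : (ey m < l)%N by have := exey m; lia.
  have := indep (fun i => row_poly c i) c0 (Ordinal lt).
  by rewrite -(row_polyE c m) /= => ->; rewrite coef0.
move=> v vreg; have sv : global_section iota e x y (pairing D v).
  move=> p j Cp pj j2; apply: (regular_pairing l_neq0 hK hD Dx Dy Cp pj j2).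
  exact: vreg.
have [c [szc vE]] := global_section_form l_neq0 hK sv.
pose C i : {poly k} := if insub i is Some j then c j else 0.
exists (fun m => (C (ey m))`_(ex m)); apply/eq_diffD; rewrite pair vE sum_row_poly.
apply: eq_bigr => i _; congr (evx _ * _); apply/polyP => a.
have [le|lt] := leqP (a + i) e.
  have [m [<- mi]] := exey_surj le.
  by rewrite -mi row_polyE mi /C valK.
rewrite row_poly0 // nth_default // (leq_trans (szc i)) //; lia.
Qed.

End Genus.

Lemma map_fermat (k k' : fieldType) (f : {rmorphism k -> k'}) l :
  map_mpoly f (fermat k l) = fermat k' l.
Proof. by rewrite rmorphB rmorphD !rmorphXn /= !map_mpolyX. Qed.

Theorem fermat_genus (k : fieldType) (e : nat) :
  (e.+3%:R : k) != 0 -> has_genus (fermat k e.+3) 'C(e.+2, 2).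
Proof.
move=> l0 kbar iota _; have lbar : (e.+3%:R : kbar) != 0.
  by rewrite -(rmorph_nat iota) fmorph_eq0.
have [z zl] := exists_root (-1 : kbar) (isT : 0 < e.+3)%N.
have [w [wE wz]] := simple_root lbar zl.
have mu1 : mup z ('X^(e.+3) + 1) = 1%N.
  by rewrite wE mupMr ?rootE // -['X - _]expr1 mup_XsubCX eqxx.
have [K [j [x [y hK]]]] := exists_fermat_field (isT : 0 < e.+3)%N mu1.
exists K, j, (generic_point x y); rewrite map_fermat; split.
  exact: (fermat_function_field _ hK).
rewrite -card_monomial_exponents; exists (@basis_diff K e x y).
exact: fermat_regular_basis.
Qed.

Lemma mderiv_Xn (R : comNzRingType) n (i j : 'I_n) m :
  ('X_j ^+ m)^`M(i) = (j == i)%:R *: ('X_j ^+ m.-1 *+ m) :> {mpoly R[n]}.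
Proof.
have X1 : 'X_j^`M(i) = (j == i)%:R%:MP :> {mpoly R[n]}.
  rewrite mderivX mnm1E; case: eqP => [->|_]; last by rewrite scale0r mpolyC0.
  have -> : (U_(i) - U_(i) = 0)%MM by apply/mnmP => a; rewrite mnmBE mnm0E subnn.
  by rewrite mpolyX0 scale1r mpolyC1.
elim: m => [|m IHm]; first by rewrite expr0 mulr0n scaler0 -mpolyC1 mderivC.
rewrite exprS mderivM IHm X1 mul_mpolyC -scalerAr -scalerDr.
case: m {IHm} => [|m]; first by rewrite mulr0n mulr0 addr0 mulr1n.
by rewrite /= mulrnAr -exprS -mulrS.
Qed.

Lemma meval_mderiv_Xn (R : comNzRingType) n (i j : 'I_n) m (v : 'I_n -> R) :
  (('X_j ^+ m)^`M(i)).@[v] = (j == i)%:R * (v j ^+ m.-1 *+ m).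
Proof. by rewrite mderiv_Xn mevalZ mevalMn rmorphXn /= mevalXU. Qed.

Lemma fermat_nonsingular (k : fieldType) (l : nat) :
  (l%:R : k) != 0 -> nonsingular_curve (fermat k l).
Proof.
move=> l0; have lgt0 : (0 < l)%N by case: l l0 => //; rewrite eqxx.
split; first by exists l => //; apply: fermat_homog.
move=> kbar iota _; rewrite map_fermat => p [p0 _].
have lbar : (l%:R : kbar) != 0 by rewrite -(rmorph_nat iota) fmorph_eq0.
have pl i : p 0 i != 0 -> p 0 i ^+ l.-1 *+ l != 0.
  by move=> pi; rewrite -mulr_natl mulf_neq0 // expf_neq0.
have Fi i : (fermat kbar l)^`M(i).@[p 0] = (1 == i)%:R * (p 0 1 ^+ l.-1 *+ l)
    - ((0 == i)%:R * (p 0 0 ^+ l.-1 *+ l) + (2 == i)%:R * (p 0 2 ^+ l.-1 *+ l)).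
  by rewrite mderivB mderivD mevalB mevalD !meval_mderiv_Xn.
have [p00|p00] := eqVneq (p 0 0) 0; last first.
  by exists 0; rewrite Fi /= !mul0r mul1r addr0 add0r oppr_eq0 pl.
have [p01|p01] := eqVneq (p 0 1) 0; last first.
  by exists 1; rewrite Fi /= !mul0r mul1r addr0 subr0 pl.
have p02 : p 0 2 != 0 by apply: contraNneq p0 => p02; rewrite (row3_eq0 p00 p01 p02).
by exists 2; rewrite Fi /= !mul0r mul1r !add0r oppr_eq0 pl.
Qed.

(** * Roots of additive polynomials over finite fields of characteristic 2 *)

(** X^|k| - X splits over k with simple roots. *)
Lemma card_roots_dvd (k : finFieldType) (p : {poly k}) :
  p %| 'X^#|k| - 'X -> #|[set x | root p x]| = (size p).-1.
Proof.
rewrite finField_genPoly => /dvdp_prod_XsubC[b pE]; set r := mask _ _ in pE.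
have ur : uniq r by rewrite mask_uniq // index_enum_uniq.
rewrite (eqp_size pE) size_prod_XsubC /= -(card_uniqP ur).
by apply: eq_card => x; rewrite inE (eqp_root pE) root_prod_XsubC.
Qed.

Lemma frob2D (R : comNzRingType) (x y : R) n :
  2%N \in [pchar R] -> (x + y) ^+ (2 ^ n) = x ^+ (2 ^ n) + y ^+ (2 ^ n).
Proof. by move=> R2; apply: exprDn_pchar; rewrite pnatX pnatE // R2. Qed.

Lemma frob2_sum (R : comNzRingType) (I : Type) (r : seq I) (F : I -> R) n :
  2%N \in [pchar R] ->
  (\sum_(i <- r) F i) ^+ (2 ^ n) = \sum_(i <- r) F i ^+ (2 ^ n).
Proof.
move=> R2; apply: (big_morph (fun x => x ^+ (2 ^ n))) => [x y|].
  exact: frob2D.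
by rewrite expr0n gtn_eqF ?expn_gt0.
Qed.

Lemma addrr2 (R : comNzRingType) (x : R) : 2%N \in [pchar R] -> x + x = 0.
Proof. by move=> R2; rewrite -mulr2n -mulr_natr (pcharf0 R2) mulr0. Qed.

Lemma oppr2 (R : comNzRingType) (x : R) : 2%N \in [pchar R] -> - x = x.
Proof. by move=> R2; apply/eqP; rewrite -subr_eq0 -opprD addrr2 ?oppr0. Qed.

Lemma addr2_eq0 (R : comNzRingType) (x y : R) :
  2%N \in [pchar R] -> (x + y == 0) = (x == y).
Proof. by move=> R2; rewrite addr_eq0 oppr2. Qed.

(** X^(t^(N+1)) + X = (X^(t^N) + X)^t + (X^t + X) for t a power of 2. *)
Lemma dvd_fixed_poly (k : fieldType) n N : 2%N \in [pchar k] ->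
  ('X^(2 ^ n) + 'X : {poly k}) %| 'X^((2 ^ n) ^ N) + 'X.
Proof.
move=> k2; have p2 : 2%N \in [pchar {poly k}] by rewrite pchar_poly.
elim: N => [|N IHN]; first by rewrite expn0 expr1 addrr2 ?dvdp0.
have -> : 'X^((2 ^ n) ^ N.+1) + 'X
    = ('X^((2 ^ n) ^ N) + 'X) ^+ (2 ^ n) + ('X^(2 ^ n) + 'X) :> {poly k}.
  by rewrite frob2D // -exprM -expnSr -[RHS]addrA [X in _ = _ + X]addrA addrr2 ?add0r.
by apply: dvdp_add => //; apply: dvdp_exp; rewrite ?expn_gt0.
Qed.

(** * Counting vectors and points of the projective plane *)
Lemma card_pairs_set (T1 T2 : finType) (P : T1 -> T2 -> bool) :
  #|[set xy : T1 * T2 | P xy.1 xy.2]| = (\sum_x #|[set y | P x y]|)%N.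
Proof.
rewrite -sum1_card; under [RHS]eq_bigr do rewrite -sum1_card.
rewrite pair_big_dep /=; apply: eq_bigl => xy.
by rewrite !inE.
Qed.

Lemma meval_homogZ (k : fieldType) d (F : {mpoly k[3]}) (c : k) (v : 'rV[k]_3) :
  F \is d.-homog -> F.@[(c *: v) 0] = c ^+ d * F.@[v 0].
Proof.
apply: (homog_ind (P := fun F => F.@[(c *: v) 0] = c ^+ d * F.@[v 0]))
  => {F} [|G H hG hH|b i j h <-]; first by rewrite !meval0 mulr0.
  by rewrite !mevalD hG hH mulrDr.
by rewrite !mevalZ !mevalM !rmorphXn /= !mevalXU !mxE !exprMn !exprD; ring.
Qed.

Lemma card_proj_point (k : finFieldType) (v : 'rV[k]_3) :
  v != 0 -> #|proj_point v| = #|k|.-1.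
Proof.
move=> v0; rewrite card_in_imset; last first.
  by move=> a b _ _ /eqP; rewrite -subr_eq0 -scalerBl scaler_eq0 (negPf v0) orbF subr_eq0 => /eqP.
by rewrite -(cardC1 (0 : k)); apply: eq_card => a; rewrite !inE.
Qed.

Lemma proj_point_eq (k : finFieldType) (v w : 'rV[k]_3) :
  (proj_point v == proj_point w) = (v \in proj_point w).
Proof.
apply/eqP/imsetP => [e|[a a0 ->]].
  have : v \in proj_point w by rewrite -e; apply/imsetP; exists 1; rewrite ?scale1r ?inE ?oner_eq0.
  by case/imsetP => a a0 ->; exists a.
rewrite inE in a0; apply/setP => u; apply/imsetP/imsetP => -[b b0 ->]; rewrite inE in b0.
  by exists (b * a); rewrite ?inE ?mulf_neq0 // scalerA.
by exists (b / a); rewrite ?inE ?mulf_neq0 ?invr_eq0 // scalerA divfK.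
Qed.

Lemma card_rational_points (k : finFieldType) d (F : {mpoly k[3]}) :
  (0 < d)%N -> F \is d.-homog ->
  #|[set v : 'rV[k]_3 | F.@[v 0] == 0]| = (#|rational_points F| * #|k|.-1).+1.
Proof.
move=> d0 hF; rewrite (cardsD1 0) inE.
have -> : F.@[(0 : 'rV[k]_3) 0] = 0.
  by have := meval_homogZ 0 0 hF; rewrite scale0r expr0n gtn_eqF // mul0r.
rewrite eqxx; congr _.+1.
pose V := [set v : 'rV[k]_3 | (v != 0) && (F.@[v 0] == 0)].
transitivity #|V|; first by apply: eq_card => v; rewrite !inE.
have rpE : rational_points F = @proj_point k @: V.
  by apply/setP => P; apply/imsetP/imsetP => -[v vV ->]; exists v; rewrite // !inE in vV *.
rewrite -sum1_card (partition_big (@proj_point k) (mem (rational_points F))) /=; last first.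
  by move=> v vV; rewrite rpE imset_f.
rewrite -sum_nat_const; apply: eq_bigr => P; rewrite rpE => /imsetP[w wV ->].
have [w0 Fw] : w != 0 /\ F.@[w 0] == 0 by move: wV; rewrite inE => /andP.
rewrite -(card_proj_point w0) sum1dep_card; apply: eq_card => v.
rewrite inE proj_point_eq andb_idl // => /imsetP[a]; rewrite inE => a0 ->.
by rewrite !inE scaler_eq0 negb_or a0 w0 (meval_homogZ _ _ hF) (eqP Fw) mulr0 eqxx.
Qed.

(** * The trace and the number of points *)
Lemma PoszX (x n : nat) : (x ^ n)%N%:Z = x%:Z ^+ n :> int.
Proof. by rewrite -!natz natrX. Qed.

(** Here x = n_0 and y = n_1, and S stands for n_0 - n_1.  The two quadratic
    relations give (s - 1) S^2 = (s - 1) s^2 Q, so S = T or S = - T for T = s^(m+1).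
    With s = -1 modulo s + 1, the relation s n_0 = Q + (s - 1) S and n_0 = 1 give
    2 S = 2; the wrong sign would make s + 1, odd and at least 3, divide 4. *)
Lemma sign_by_congruence (s m x y Q R N : nat) :
  (1 < s)%N -> ~~ odd s -> Q = (s ^ m.*2)%N -> (s ^ 2 <= Q)%N -> (R * s = Q)%N ->
  (x + s.-1 * y = Q)%N -> (x ^ 2 + s.-1 * y ^ 2 = s ^ 2 * Q + (Q - s ^ 2) * R)%N ->
  x = (N * s.+1).+1 ->
  (s * x)%N%:Z = Q%:Z - (-1) ^+ m * (s.-1 * s ^ m.+1)%N%:Z :> int.
Proof.
move=> s_gt1 s_even QE leQ RE tot sq NE.
have s_gt0 : (0 < s)%N by exact: ltnW.
have sP : s.-1%:Z = s%:Z - 1 :> int by rewrite -subn1 -subzn.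
pose S : int := x%:Z - y%:Z; pose T : int := (s ^ m.+1)%N%:Z.
have totZ : x%:Z + (s%:Z - 1) * y%:Z = Q%:Z :> int by rewrite -tot PoszD PoszM sP.
have REZ : R%:Z * s%:Z = Q%:Z :> int by rewrite -PoszM RE.
have sqZ : x%:Z ^+ 2 + (s%:Z - 1) * y%:Z ^+ 2
    = s%:Z ^+ 2 * Q%:Z + (Q%:Z - s%:Z ^+ 2) * R%:Z :> int.
  by move/(congr1 Posz): sq; rewrite !PoszD !PoszM sP -subzn // -!mulnn !PoszM -!expr2.
have s1 : s%:Z - 1 != 0 :> int by rewrite -sP; case: (s) s_gt1 => [|[]].
have T2 : T ^+ 2 = s%:Z ^+ 2 * Q%:Z.
  by rewrite /T QE -!PoszX -PoszM -!expnM -expnD; congr (Posz (s ^ _)); lia.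
have S2 : S ^+ 2 = T ^+ 2.
  apply: (mulfI s1); rewrite T2 /S.
  transitivity (s%:Z * (x%:Z ^+ 2 + (s%:Z - 1) * y%:Z ^+ 2)
                - (x%:Z + (s%:Z - 1) * y%:Z) ^+ 2); first by ring.
  by rewrite sqZ totZ -REZ; ring.
have sx : (s * x)%N%:Z = Q%:Z + (s%:Z - 1) * S :> int.
  by rewrite PoszM -totZ /S; ring.
have dvd_pow N0 : exists A : int, s%:Z ^+ N0 = (-1) ^+ N0 + (s%:Z + 1) * A.
  have := subrXX (s%:Z : int) (-1) N0; rewrite opprK.
  by set A := \sum_(i < N0) _ => eA; exists A; rewrite -eA addrC subrK.
have [A TA] := dvd_pow m.+1; rewrite -PoszX -/T in TA.
have [B QB] := dvd_pow m.*2; rewrite -PoszX -QE -[X in X + _]signr_odd odd_double in QB.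
have xN : x%:Z = N%:Z * (s%:Z + 1) + 1 :> int by rewrite NE; lia.
(* S is 1 modulo s + 1, so it cannot be -1. *)
have bad C : S = -1 + (s%:Z + 1) * C -> False.
  move=> SE; have := sx; rewrite PoszM QB SE xN expr0 => e.
  have d4 : 4 = (2 - B - (s%:Z - 1) * C + s%:Z * N%:Z) * (s%:Z + 1) :> int.
    by apply/eqP; rewrite -subr_eq0; apply/eqP; move/esym/eqP: e; rewrite -subr_eq0 => /eqP <-; ring.
  have : (s.+1 %| 4)%N.
    suff : (s.+1%:Z %| 4%:Z)%Z by [].
    have s1E : s.+1%:Z = s%:Z + 1 :> int by lia.
    by apply/dvdzP; exists (2 - B - (s%:Z - 1) * C + s%:Z * N%:Z); rewrite s1E -d4.
  move=> d; have := @dvdn_leq _ 4 isT d; move: s_even d s_gt1.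
  by case: (s) => [|[|[|[|]]]].
rewrite sx PoszM sP -/T; move: TA; rewrite exprS mulN1r.
rewrite -[(-1) ^+ m]signr_odd; case: (odd m); rewrite ?expr1 ?expr0.
- rewrite opprK => TA; move/eqP: S2; rewrite eqf_sqr => /orP[] /eqP SE.
    by rewrite SE; ring.
  by apply: False_ind; apply: (bad (- A)); rewrite SE TA; ring.
- move=> TA; move/eqP: S2; rewrite eqf_sqr => /orP[] /eqP SE.
    by apply: False_ind; apply: (bad A); rewrite SE TA.
  by rewrite SE; ring.
Qed.

Lemma sqrtC_nat_sqr (N : nat) : sqrtC (N ^ 2)%N%:R = N%:R :> algC.
Proof. by rewrite natrX sqrCK ?ler0n. Qed.

Section HermitianPoints.

Variables (k : finFieldType) (a m : nat).
Local Notation s := (2 ^ a)%N.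
Local Notation q := (s ^ 2)%N.
Local Notation Q := #|k|.
Local Notation l := s.+1.
Hypotheses (a_gt0 : (0 < a)%N) (m_gt0 : (0 < m)%N) (card_k : Q = (q ^ m)%N).

Lemma card_k_s : Q = (s ^ m.*2)%N. Proof. by rewrite card_k -expnM mul2n. Qed.
Lemma s_gt1 : (1 < s)%N. Proof. by rewrite -{1}(expn0 2) ltn_exp2l. Qed.
Let s_gt0 : (0 < s)%N. Proof. exact: ltnW s_gt1. Qed.

Lemma pchar2 : 2%N \in [pchar k].
Proof. by apply: (@card_finPcharP _ _ (a * m.*2)) => //; rewrite card_k_s expnM. Qed.
Let k2 := pchar2.

Let frob (x y : k) : (x + y) ^+ s = x ^+ s + y ^+ s. Proof. exact: frob2D. Qed.

Let p2 : 2%N \in [pchar {poly k}]. Proof. by rewrite pchar_poly. Qed.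

Lemma card_roots (p : {poly k}) : p %| 'X^Q + 'X ->
  #|[set x | root p x]| = (size p).-1.
Proof. by move=> pdvd; apply: card_roots_dvd; rewrite oppr2. Qed.

Lemma dvd_q : ('X^q + 'X : {poly k}) %| 'X^Q + 'X.
Proof. by rewrite card_k -expnM; apply: dvd_fixed_poly. Qed.

Lemma dvd_s_q : ('X^s + 'X : {poly k}) %| 'X^q + 'X.
Proof. exact: dvd_fixed_poly. Qed.

Let size_XnX t : (1 < t)%N -> size ('X^t + 'X : {poly k}) = t.+1.
Proof. by move=> t1; rewrite size_polyDl ?size_polyXn // size_polyX. Qed.

Lemma card_fixed_q : #|[set z : k | z ^+ q == z]| = q.
Proof.
have := card_roots dvd_q; rewrite size_XnX ?(leq_trans s_gt1) ?leq_exp2l //; last first.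
  by rewrite -{1}(expn1 s) leq_pexp2l.
move=> /= cE; rewrite -[RHS]cE; apply: eq_card => z.
by rewrite !inE rootE !hornerE addr2_eq0.
Qed.

Lemma card_fixed_s : #|[set z : k | z ^+ s == z]| = s.
Proof.
have := card_roots (dvdp_trans dvd_s_q dvd_q); rewrite size_XnX ?s_gt1 //= => cE; rewrite -[RHS]cE.
by apply: eq_card => z; rewrite !inE rootE !hornerE addr2_eq0.
Qed.

(** P = X^s + X + 1 divides P^s + P = X^q + X. *)
Lemma exists_artin_schreier_root : exists al : k, al ^+ s = al + 1.
Proof.
pose P : {poly k} := 'X^s + ('X + 1).
have szP : size P = s.+1.
  by rewrite size_polyDl size_polyXn // -polyC1 size_XaddC ltnS s_gt1.
have Pdvd : P %| 'X^Q + 'X.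
  apply: dvdp_trans dvd_q.
  have -> : 'X^q + 'X = P ^+ s + P.
    rewrite /P !frob2D // expr1n -exprM mulnn.
    rewrite [RHS](_ : _ = 'X^q + 'X + ('X^s + 'X^s) + (1 + 1)); last by ring.
    by rewrite !addrr2 // !addr0.
  by rewrite dvdp_add // dvdp_exp.
have : (0 < #|[set x | root P x]|)%N by rewrite card_roots // szP.
case/card_gt0P => al; rewrite inE rootE /P !(hornerD, hornerXn, hornerX, hornerC) addr2_eq0 // => /eqP e.
by exists al.
Qed.

(** The nonzero c with c^s = c are the norms of the field with q elements: X^l - c
    divides (X^l)^(s-1) - c^(s-1) = X^(q-1) - 1. *)
Lemma card_norm_preimage (c : k) : c != 0 -> c ^+ s = c ->
  #|[set d : k | d ^+ l == c]| = l.
Proof.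
move=> c0 cs; pose P : {poly k} := 'X^l - c%:P.
have szP : size P = l.+1 by rewrite size_XnsubC.
have Pdvd : P %| 'X^Q + 'X.
  apply: dvdp_trans dvd_q; apply/dvdpP.
  have cs1 : c ^+ s.-1 = 1 by apply: (mulfI c0); rewrite -exprS prednK // mulr1.
  have := subrXX 'X^l c%:P s.-1; rewrite -rmorphXn cs1 -exprM => e.
  have ls : (l * s.-1).+1 = q by have := s_gt0; case: (s) => // n _; lia.
  exists ((\sum_(i < s.-1) 'X^l ^+ (s.-1.-1 - i) * c%:P ^+ i) * 'X).
  by rewrite mulrAC [_ * P]mulrC -e mulrBl -exprSr ls mul1r oppr2.
have := card_roots Pdvd; rewrite szP /= => cE; rewrite -[RHS]cE.
by apply: eq_card => d; rewrite !inE rootE !hornerE subr_eq0.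
Qed.

(** The trace from k to its subfield with s elements; m.*2 is the degree. *)
Definition Tr (z : k) : k := \sum_(i < m.*2) z ^+ (s ^ i).

Let frob_s (R : comNzRingType) (x y : R) i : 2%N \in [pchar R] ->
  (x + y) ^+ (s ^ i) = x ^+ (s ^ i) + y ^+ (s ^ i).
Proof. by rewrite -expnM; apply: frob2D. Qed.

Lemma TrD y z : Tr (y + z) = Tr y + Tr z.
Proof. by rewrite -big_split; apply: eq_bigr => i _; apply: frob_s. Qed.

Lemma Tr_frob z : Tr (z ^+ s) = Tr z.
Proof.
rewrite /Tr; have /prednK <- : (0 < m.*2)%N by rewrite double_gt0.
rewrite [LHS]big_ord_recr [RHS]big_ord_recl /= expr1 addrC -exprM -expnS.
rewrite prednK ?double_gt0 // -card_k_s expf_card; congr (_ + _).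
by apply: eq_bigr => i _; rewrite -exprM -expnS.
Qed.

Lemma Tr_fixed z : Tr z ^+ s = Tr z.
Proof.
rewrite -{2}Tr_frob /Tr frob2_sum //; apply: eq_bigr => i _.
by rewrite -!exprM mulnC.
Qed.

Lemma TrZ c z : c ^+ s = c -> Tr (c * z) = c * Tr z.
Proof.
move=> cs; rewrite /Tr mulr_sumr; apply: eq_bigr => i _; rewrite exprMn.
congr (_ * _); elim: (nat_of_ord i) => [|j IHj]; first by rewrite expn0 expr1.
by rewrite expnS exprM cs.
Qed.

(** P = Tr(X) + c divides P^s + P = X^Q + X and has degree Q / s. *)
Lemma card_trace_fiber c : c ^+ s = c -> (#|[set z | Tr z == c]| * s = Q)%N.
Proof.
move=> cs; pose N := m.*2.-1.
have NE : N.+1 = m.*2 by rewrite prednK // double_gt0.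
pose P : {poly k} := \sum_(i < N.+1) 'X^(s ^ i) + c%:P.
have szP : size P = (s ^ N).+1.
  rewrite /P big_ord_recr /= addrAC addrC size_polyDl size_polyXn //.
  rewrite ltnS (leq_trans (size_polyD _ _)) // geq_max; apply/andP; split.
    apply: (leq_trans (size_sum _ _ _)); apply/bigmax_leqP => i _.
    by rewrite size_polyXn ltn_exp2l ?s_gt1.
  by rewrite (leq_trans (size_polyC_leq1 _)) // expn_gt0 s_gt0.
have Pdvd : P %| 'X^Q + 'X.
  have -> : 'X^Q + 'X = P ^+ s + P.
    rewrite frob2D // frob2_sum // -rmorphXn cs /P.
    rewrite [X in X + _ + _]big_ord_recr [X in _ + (X + _)]big_ord_recl /=.
    rewrite expr1 -exprM -expnSr NE -card_k_s.
    set A := \sum_(i < N) _; set B := \sum_(i < N) _.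
    have -> : B = A by apply: eq_bigr => i _; rewrite -exprM -expnSr.
    rewrite [RHS](_ : _ = 'X^Q + 'X + (A + A) + (c%:P + c%:P)); last by ring.
    by rewrite !addrr2 // !addr0.
  by rewrite dvdp_add // dvdp_exp.
have -> : [set z | Tr z == c] = [set z | root P z].
  apply/setP => z; rewrite !inE rootE /P hornerD hornerC horner_sum addr2_eq0 //.
  by rewrite /Tr NE; under [in RHS]eq_bigr do rewrite hornerXn.
by rewrite card_roots // szP /= -expnSr NE card_k_s.
Qed.

(** If Tr c = 0, then the sum of the P^(s^i) for P = X^s + X + c telescopes to
    X^Q + X, so P splits over k with simple roots. *)
Lemma card_artin_schreier c :
  #|[set y : k | y ^+ s + y == c]| = if Tr c == 0 then s else 0%N.
Proof.
case: eqP => [c0|c0]; last first.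
  apply/eqP; rewrite cards_eq0; apply/eqP/setP => y; rewrite !inE.
  by apply/eqP => yc; case: c0; rewrite -yc TrD Tr_frob addrr2.
pose P : {poly k} := 'X^s + 'X + c%:P.
have szP : size P = s.+1.
  rewrite /P -addrA size_polyDl size_polyXn // ltnS size_XaddC.
  exact: s_gt1.
have Pdvd : P %| 'X^Q + 'X.
  have -> : 'X^Q + 'X = \sum_(i < m.*2) P ^+ (s ^ i).
    pose R N : {poly k} := \sum_(i < N) P ^+ (s ^ i).
    have RE N : R N = 'X^(s ^ N) + 'X + \sum_(i < N) (c ^+ (s ^ i))%:P.
      elim: N => [|N IHN]; first by rewrite /R !big_ord0 expn0 expr1 addr0 addrr2.
      rewrite /R big_ord_recr /= -/(R N) IHN [in RHS]big_ord_recr /=.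
      rewrite !frob_s // -exprM -expnS rmorphXn.
      set A := 'X^(s ^ N); set B := 'X^(s ^ _); set C := \sum_(i < N) _.
      rewrite [LHS](_ : _ = B + 'X + (C + c%:P ^+ (s ^ N)) + (A + A)); last by ring.
      by rewrite addrr2 // addr0.
    rewrite -/(R _) RE -card_k_s -rmorph_sum -/(Tr c) c0 rmorph0.
    by rewrite addr0.
  elim/big_ind: _ => [|? ?|i _]; [exact: dvdp0 | exact: dvdp_add |].
  by rewrite dvdp_exp // expn_gt0 s_gt0.
have := card_roots Pdvd; rewrite szP /= => cE; rewrite -[RHS]cE.
by apply: eq_card => y; rewrite !inE rootE !hornerE addr2_eq0.
Qed.

(** x |-> Tr (x^l) is a quadratic form on k over the field with s elements. *)
Definition norm_fiber (c : k) : {set k} := [set x | Tr (x ^+ l) == c].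
Local Notation n0 := #|norm_fiber 0%R|.
Local Notation n1 := #|norm_fiber 1%R|.

(** If c = d^l, the multiplication by d maps the fiber of 1 to that of c. *)
Lemma card_norm_fiber c : c != 0 -> c ^+ s = c -> #|norm_fiber c| = n1.
Proof.
move=> c0 cs; have : (0 < #|[set d : k | d ^+ l == c]|)%N.
  by rewrite card_norm_preimage.
case/card_gt0P => d; rewrite inE => /eqP dl.
have d0 : d != 0 by apply: contraNneq c0 => d0; rewrite -dl d0 expr0n.
rewrite -(card_imset (norm_fiber 1) (mulfI d0)); apply: eq_card => x; apply/idP/imsetP.
  rewrite inE => /eqP xc; exists (d^-1 * x); last by rewrite mulVKf.
  have csV : c^-1 ^+ s = c^-1 by rewrite exprVn cs.
  by rewrite inE exprMn exprVn dl TrZ // xc mulVf.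
by case=> y; rewrite !inE => /eqP y1 ->; rewrite exprMn dl TrZ // y1 mulr1.
Qed.

Lemma sum_norm_fibers (f : nat -> nat) : f 0%N = 0%N ->
  (\sum_c f #|norm_fiber c| = f n0 + s.-1 * f n1)%N.
Proof.
move=> f0; pose A := [set c : k | c ^+ s == c].
have cA : #|A :\ 0| = s.-1.
  have := cardsD1 0 A; rewrite card_fixed_s inE expr0n gtn_eqF //.
  by rewrite eqxx => ->.
rewrite (bigD1 0) //=; congr (_ + _)%N; rewrite -cA -sum_nat_const.
rewrite (bigID (mem A)) /= [X in (_ + X)%N]big1 ?addn0 => [|c /andP[_ cA']].
  apply: eq_big => [c|c /andP[c0]]; first by rewrite !inE.
  by rewrite inE => /eqP cs; rewrite card_norm_fiber.
rewrite (_ : norm_fiber c = set0) ?cards0 //; apply/setP => x; rewrite !inE.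
by apply: contraNF cA' => /eqP <-; rewrite inE Tr_fixed.
Qed.

Lemma norm_fibers_total : (n0 + s.-1 * n1 = Q)%N.
Proof.
rewrite -(sum_norm_fibers (f := id)) //.
rewrite -[RHS]sum1_card [RHS](partition_big (fun x => Tr (x ^+ l)) predT) //=.
by apply: eq_bigr => c _; rewrite -sum1_card; apply: eq_bigl => x; rewrite inE.
Qed.

Lemma norm_fibers_squares :
  #|[set xy : k * k | Tr (xy.1 ^+ l + xy.2 ^+ l) == 0]| = (n0 ^ 2 + s.-1 * n1 ^ 2)%N.
Proof.
rewrite (card_pairs_set (fun x y => Tr (x ^+ l + y ^+ l) == 0)).
rewrite -(sum_norm_fibers (f := fun n => (n ^ 2)%N)) //.
rewrite (partition_big (fun x => Tr (x ^+ l)) predT) //=; apply: eq_bigr => c _.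
rewrite (eq_bigr (fun=> #|norm_fiber c|)) => [|x /eqP xc].
  by rewrite sum_nat_const -mulnn; congr (_ * _)%N; apply: eq_card => x; rewrite !inE.
by apply: eq_card => y; rewrite !inE TrD xc addr2_eq0 // eq_sym.
Qed.

(** This linear change of variables, of determinant 1, replaces the diagonal form
    U^l + V^l by u^s z + u z^s. *)
Lemma hermitian_polarization (al u z : k) : al ^+ s = al + 1 ->
  (u + al * z) ^+ l + (u + al * z + z) ^+ l = u ^+ s * z + u * z ^+ s.
Proof.
move=> als; rewrite !exprSr !frob !exprMn als.
have two : 1 + 1 = 0 :> k by rewrite addrr2.
rewrite [LHS](_ : _ = u ^+ s * z + u * z ^+ s + (1 + 1) *
  (u ^+ s * u + al * u ^+ s * z + (al + 1) * z ^+ s * u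
   + (al + 1) ^+ 2 * z ^+ s * z)); last by ring.
by rewrite two mul0r addr0.
Qed.

Lemma frob_inj : injective (fun u : k => u ^+ s).
Proof.
move=> u v /eqP; rewrite -addr2_eq0 // -frob expf_eq0 s_gt0 /= addr2_eq0 //.
by move/eqP.
Qed.

(** After the change of variables the condition is Tr (u^s (z + z^q)) = 0, because
    Tr (u z^s) = Tr (u^s z^q).  If z^q = z it holds for all u; otherwise
    u |-> u^s (z + z^q) is a bijection onto k, and R is the size of the kernel of
    the trace. *)
Lemma card_isotropic_pairs : exists R, (R * s = Q)%N /\
  #|[set xy : k * k | Tr (xy.1 ^+ l + xy.2 ^+ l) == 0]| = (q * Q + (Q - q) * R)%N.
Proof.
pose R := #|[set z | Tr z == 0]|.
have RE : (R * s = Q)%N.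
  by apply: card_trace_fiber; rewrite expr0n gtn_eqF.
exists R; split=> //; have [al als] := exists_artin_schreier_root.
pose h (zu : k * k) := (zu.2 + al * zu.1, zu.2 + al * zu.1 + zu.1).
have h_inj : injective h.
  move=> [z u] [z' u'] [/= e1]; rewrite e1 => /addrI ez.
  by move: e1; rewrite ez => /addIr->.
rewrite -(card_preimset _ h_inj).
have -> : h @^-1: [set xy | Tr (xy.1 ^+ l + xy.2 ^+ l) == 0]
    = [set zu : k * k | Tr (zu.2 ^+ s * (zu.1 + zu.1 ^+ q)) == 0].
  apply/setP => -[z u]; rewrite !inE /= hermitian_polarization //.
  by rewrite mulrDr !TrD -[Tr (u * _)]Tr_frob exprMn -exprM mulnn.
rewrite (card_pairs_set (fun z u => Tr (u ^+ s * (z + z ^+ q)) == 0)).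
rewrite (bigID (fun z : k => z ^+ q == z)) /=; congr (_ + _)%N.
  rewrite -[in RHS]card_fixed_q -sum_nat_const.
  apply: eq_big => [z|z /eqP zq]; first by rewrite inE.
  rewrite zq -[RHS]cardsT; apply: eq_card => u; rewrite !inE addrr2 // mulr0.
  by rewrite -(mul0r 0) TrZ ?mul0r ?eqxx // expr0n gtn_eqF.
have -> : (Q - q)%N = #|[pred z : k | z ^+ q != z]|.
  rewrite -[in LHS]card_fixed_q -(cardC [pred z : k | z ^+ q == z]).
  rewrite (_ : #|[set z | z ^+ q == z]| = #|[pred z : k | z ^+ q == z]|).
    by rewrite addKn; apply: eq_card => z; rewrite !inE.
  by apply: eq_card => z; rewrite !inE.
rewrite -sum_nat_const; apply: eq_big => [//|z zq].
have w0 : z + z ^+ q != 0 by rewrite addr2_eq0 // eq_sym.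
have g_inj : injective (fun u => u ^+ s * (z + z ^+ q)).
  by move=> u v /(mulIf w0) /frob_inj.
rewrite /R -(card_preimset _ g_inj); apply: eq_card => u.
by rewrite !inE.
Qed.

(** The nonempty fibers of x |-> x^l on nonzero elements have l elements. *)
Lemma dvdn_norm_fiber0 : (l %| #|norm_fiber 0%R :\ 0%R|)%N.
Proof.
rewrite -sum1_card (partition_big (fun x => x ^+ l) predT) //=.
apply: (big_ind (fun N => l %| N)%N) => [|x y|t _]; [exact: dvdn0 | exact: dvdn_add |].
rewrite sum1dep_card; set A := [set x | _].
have [->|[x]] := set_0Vmem A; first by rewrite cards0 dvdn0.
rewrite !inE => /andP[/andP[x0 xT] /eqP xt].
suff -> : #|A| = l by [].
rewrite -[RHS](card_norm_preimage (oner_neq0 k)) ?expr1n //.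
rewrite -[RHS](card_imset _ (mulfI x0)); apply: eq_card => y.
have tT : Tr t == 0 by rewrite -xt.
apply/idP/imsetP => [|[z zl ->]].
  rewrite !inE => /andP[/andP[y0 _] /eqP yt]; exists (x^-1 * y); last by rewrite mulVKf.
  by rewrite inE exprMn exprVn xt yt mulVf // -xt expf_neq0.
move: zl; rewrite inE => /eqP zl.
have z0 : z != 0 by apply: contraTneq (oner_neq0 k) => z0; rewrite -zl z0 expr0n eqxx.
by rewrite !inE mulf_neq0 // exprMn zl mulr1 xt tT eqxx.
Qed.

Lemma card_norm_fiber0 :
  (s * n0)%:Z = Q%:Z - (-1) ^+ m * (s.-1 * s ^ m.+1)%:Z :> int.
Proof.
have [R [RE]] := card_isotropic_pairs; rewrite norm_fibers_squares => sq.
have tot := norm_fibers_total.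
have n0E : n0 = #|norm_fiber 0%R :\ 0%R|.+1.
  rewrite (cardsD1 0 (norm_fiber 0)) inE expr0n /=.
  by rewrite (_ : Tr 0 == 0) // -(mul0r 0) TrZ ?mul0r ?eqxx // expr0n gtn_eqF.
have [N NE] : exists N, n0 = (N * l).+1.
  by have /dvdnP[N NE] := dvdn_norm_fiber0; exists N; rewrite n0E NE.
have leqQ : (q <= Q)%N by rewrite card_k -{1}(expn1 q) leq_pexp2l ?expn_gt0 ?s_gt0.
apply: sign_by_congruence leqQ RE tot sq NE => //.
- exact: s_gt1.
- by rewrite oddX negb_or -lt0n a_gt0.
- exact: card_k_s.
Qed.

Lemma card_hermitian_affine :
  #|[set xu : k * k | xu.2 ^+ s + xu.2 == xu.1 ^+ l]| = (s * n0)%N.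
Proof.
rewrite (card_pairs_set (fun x u => u ^+ s + u == x ^+ l)).
under eq_bigr do rewrite card_artin_schreier.
rewrite -big_mkcond sum_nat_const mulnC; congr (_ * _)%N.
by apply: eq_card => x; rewrite !inE.
Qed.

(** The vectors with z = 0 are those with x = 0 and u arbitrary; for z <> 0 the
    substitution of (z x, z u) for (x, u) reduces the equation to the affine one. *)
Lemma card_fermat_vectors :
  #|[set v : 'rV[k]_3 | (fermat k l).@[v 0] == 0]| = (Q + Q.-1 * (s * n0))%N.
Proof.
have [al als] := exists_artin_schreier_root.
(* In the coordinates t = (z, (x, u)) the equation is u^s z + u z^s = x^l. *)
pose h (t : k * (k * k)) : 'rV[k]_3 := \row_i
  (if i == 0 then t.2.2 + al * t.1 else if i == 1 then t.2.2 + al * t.1 + t.1 else t.2.1).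
pose g (v : 'rV[k]_3) := (v 0 1 - v 0 0, (v 0 2, v 0 0 - al * (v 0 1 - v 0 0))).
have gK : cancel g h.
  move=> v; apply/rowP => i; rewrite mxE /=.
  case: i => [[|[|[|//]]] lti] /=.
  - by rewrite subrK; congr (v _ _); apply: val_inj.
  - by rewrite subrK addrC subrK; congr (v _ _); apply: val_inj.
  - by congr (v _ _); apply: val_inj.
have hK : cancel h g.
  by move=> [z [x u]]; rewrite /g !mxE /= [_ + z]addrC addrK addrK.
rewrite -(on_card_preimset (onW_bij _ (Bijective hK gK))).
have -> : h @^-1: [set v : 'rV[k]_3 | (fermat k l).@[v 0] == 0]
    = [set t : k * (k * k) | t.2.2 ^+ s * t.1 + t.2.2 * t.1 ^+ s == t.2.1 ^+ l].
  apply/setP => -[z [x u]]; rewrite !inE /fermat mevalB mevalD !rmorphXn /= !mevalXU.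
  rewrite !mxE /= oppr2 // addrA [_ + (u + al * z) ^+ l]addrC.
  by rewrite hermitian_polarization // addr2_eq0.
rewrite (card_pairs_set (fun z (xu : k * k) =>
  xu.2 ^+ s * z + xu.2 * z ^+ s == xu.1 ^+ l)).
rewrite (bigD1 0) //=; congr (_ + _)%N.
  rewrite (card_pairs_set (fun x u : k => u ^+ s * 0 + u * 0 ^+ s == x ^+ l)).
  rewrite (bigD1 0) //= big1 ?addn0 => [|x x0].
    rewrite -cardsT; apply: eq_card => u.
    by rewrite !inE !expr0n gtn_eqF // !mulr0 addr0 eqxx.
  apply/eqP; rewrite cards_eq0; apply/eqP/setP => u.
  by rewrite !inE expr0n gtn_eqF // !mulr0 addr0 eq_sym expf_eq0 /= (negPf x0).
rewrite (eq_bigr (fun=> (s * n0)%N)) => [|z z0].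
  by rewrite sum_nat_const -(cardC1 (0 : k)); congr (_ * _)%N; apply: eq_card => z; rewrite !inE.
rewrite -card_hermitian_affine.
pose f (xu : k * k) := (z * xu.1, z * xu.2).
have f_inj : injective f by move=> [x u] [x' u'] [/(mulfI z0)-> /(mulfI z0)->].
rewrite -[LHS](card_preimset _ f_inj); apply: eq_card => -[x u]; rewrite !inE /=.
have zl0 : z ^+ l != 0 by rewrite expf_neq0.
rewrite -[in RHS](inj_eq (mulfI zl0)) !exprMn; congr (_ == _).
by rewrite exprS; ring.
Qed.

Lemma card_fermat_points :
  #|rational_points (fermat k l)|%:Z
    = Q%:Z + 1 - (-1) ^+ m * (s.-1 * s ^ m.+1)%N%:Z :> int.
Proof.
have Q1 : (1 < Q)%N.
  by rewrite card_k -expnM -{1}(expn0 s) ltn_exp2l ?s_gt1 // muln_gt0.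
have := card_rational_points (isT : 0 < l)%N (fermat_homog k l).
rewrite card_fermat_vectors => e.
have Q1' : (0 < Q.-1)%N by rewrite -ltnS prednK // ltnW.
have N_E : #|rational_points (fermat k l)| = (1 + s * n0)%N.
  apply/eqP; rewrite -(eqn_pmul2r Q1'); apply/eqP; apply: succn_inj.
  by rewrite -e mulnDl mul1n [(s * n0 * _)%N]mulnC -addSn prednK // ltnW.
by rewrite N_E PoszD card_norm_fiber0; ring.
Qed.

Lemma hermitian_degree_neq0 : (l%:R : k) != 0.
Proof.
rewrite -natr1 natrX (pcharf0 pchar2) expr0n gtn_eqF // add0r.
exact: oner_neq0.
Qed.

Lemma hermitian_nonsingular : nonsingular_curve (fermat k l).
Proof. exact: fermat_nonsingular hermitian_degree_neq0. Qed.

Lemma hermitian_genus : has_genus (fermat k l) 'C(s, 2).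
Proof.
have [e sE] : exists e, s = e.+2.
  by exists (s - 2)%N; have := s_gt1; lia.
by have := hermitian_degree_neq0; rewrite sE; apply: fermat_genus.
Qed.

Lemma genus_double : (2 * 'C(s, 2) = s * s.-1)%N.
Proof. by rewrite mul2n bin2 halfK oddM oddX eqn0Ngt a_gt0 subn0. Qed.

Lemma sqrtC_card : sqrtC Q%:R = (s ^ m)%N%:R :> algC.
Proof. by rewrite card_k expnAC sqrtC_nat_sqr. Qed.

Lemma card_hermitian_points :
  #|rational_points (fermat k l)|%:R
    = Q%:R + 1 - (-1) ^+ m * (2 * 'C(s, 2)%:R * sqrtC Q%:R) :> algC.
Proof.
have := congr1 (intr : int -> algC) card_fermat_points.
rewrite rmorphB rmorphD rmorphM rmorphXn rmorphN !rmorph1 -!pmulrn => ->.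
congr (_ - _ * _); rewrite sqrtC_card -!natrM genus_double.
by congr (_%:R); rewrite expnS; ring.
Qed.

Lemma hermitian_maximal : odd m -> maximal_curve (fermat k l).
Proof.
move=> m_odd; split; first exact: hermitian_nonsingular.
exists 'C(s, 2); first exact: hermitian_genus.
by rewrite card_hermitian_points -signr_odd m_odd expr1 mulN1r opprK.
Qed.

Lemma hermitian_minimal : ~~ odd m -> minimal_curve (fermat k l).
Proof.
move=> m_even; split; first exact: hermitian_nonsingular.
exists 'C(s, 2); first exact: hermitian_genus.
by rewrite card_hermitian_points -signr_odd (negPf m_even) expr0 mul1r.
Qed.

End HermitianPoints.

Lemma base_change_fermat (k : finFieldType) (L : fieldExtType k) l :
  base_change L (fermat k l) = fermat (finvect_type L) l.
Proof. exact: map_fermat. Qed.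

Lemma card_extension (k : finFieldType) (L : fieldExtType k) :
  #|finvect_type L| = (#|k| ^ \dim {:L})%N.
Proof.
rewrite -[LHS](@card_vspacef k (finvect_type L) (Vector.class (finvect_type L))).
by rewrite card_vspace.
Qed.

Theorem mainTheorem4 (n l q g : nat) (Fq : finFieldType)
    (hl : l = (2 ^ (2 ^ n) + 1)%N) (l_prime : prime l)
    (hq : q = (2 ^ (2 ^ n.+1))%N) (card_Fq : #|Fq| = q)
    (hg : g = (2 ^ (2 ^ n - 1) * (2 ^ (2 ^ n) - 1))%N) :
  [/\ hermitian_curve (fermat Fq l) /\ l%:R = sqrtC q%:R + 1 :> algC,
      nonsingular_curve (fermat Fq l) /\ has_genus (fermat Fq l) g,
      forall L : fieldExtType Fq, odd (\dim {:L}) ->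
        maximal_curve (base_change L (fermat Fq l))
    & forall L : fieldExtType Fq, ~~ odd (\dim {:L}) ->
        minimal_curve (base_change L (fermat Fq l))].
Proof.
have a_gt0 : (0 < 2 ^ n)%N by rewrite expn_gt0.
have qE : q = ((2 ^ (2 ^ n)) ^ 2)%N by rewrite hq expnSr expnM.
have cardE : #|Fq| = (((2 ^ (2 ^ n)) ^ 2) ^ 1)%N by rewrite card_Fq qE expn1.
have gE : g = 'C(2 ^ (2 ^ n), 2).
  apply: double_inj; rewrite -!mul2n genus_double // hg mulnA -expnS.
  by rewrite -subSn // subSS subn0 subn1.
have cardL (L : fieldExtType Fq) :
    #|finvect_type L| = (((2 ^ (2 ^ n)) ^ 2) ^ \dim {:L})%N.
  by rewrite card_extension card_Fq qE.
have dimL (L : fieldExtType Fq) : (0 < \dim {:L})%N by exact: adim_gt0.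
rewrite hl addn1; split.
- split; first by exists (2 ^ (2 ^ n))%N; rewrite // card_Fq qE.
  by rewrite qE sqrtC_nat_sqr natr1.
- split; first exact: hermitian_nonsingular cardE.
  by rewrite gE; apply: hermitian_genus cardE.
- move=> L L_odd; rewrite base_change_fermat.
  exact: hermitian_maximal (cardL L) L_odd.
- move=> L L_even; rewrite base_change_fermat.
  exact: hermitian_minimal (cardL L) L_even.
Qed.
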